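(* Let $\mathcal{F}=(V,\mathcal{E}\cup\mathcal{A})$ be a mixed hypergraph, $f,g:V\to\mathbb{Z}_+$ functions, $h,\alpha,\beta\in\mathbb{Z}_+$, $S$ a multiset of vertices in $V$, and $\mathsf{M}=(S,r_{\mathsf{M}})$ a matroid. There exists an $h$-regular $\mathsf{M}$-independent-rooted $(f,g)$-bounded $(\alpha,\beta)$-limited packing of mixed hyperarborescences in $\mathcal{F}$ if and only if all of the following hold: (i) $g_h(v)\ge f(v)$ for every $v\in V$; (ii) $\alpha\le\beta$; (iii) for all $X,Z\subseteq V$, $$\max\{h,\alpha\}-r_{\mathsf{M}}(S_{\overline X})+f(Z-X)-g_h(X-Z)\le h|Z|;$$ (iv) for all $X,Z\subseteq V$ and every subpartition $\mathcal{P}$ of $Z$, $$e_{\mathcal{E}\cup\mathcal{A}}(\mathcal{P})+\min\{\beta-f(\overline Z),\ r_{\mathsf{M}}(S_X)-f(X-Z)+g_h(Z-X)\}\ge h|\mathcal{P}|.$$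
   Context: $\mathbb{Z}_+$ is the set of non-negative integers. $V$ is a finite non-empty set; $\overline X=V-X$. For a function $m$ on $V$ and $X\subseteq V$, $m(X)=\sum_{x\in X}m(x)$. For $g:V\to\mathbb{Z}_+$ and $h\in\mathbb{Z}_+$, $g_h(v)=\min\{g(v),h\}$. For a multiset $S$ of vertices, $S_X$ is the restriction of $S$ to $X$ (elements of $X$ with their multiplicities), and $S_v=S_{\{v\}}$; a matroid on $S$ treats the copies in $S$ as distinct ground-set elements, and $r_{\mathsf M}$ is its rank function. A subpartition of $Z\subseteq V$ is a (possibly empty) set of pairwise disjoint non-empty subsets of $Z$. Digraphs: an arc $uv$ is an ordered pair of distinct vertices (tail $u$, head $v$); parallel arcs are allowed. A digraph $(U,B)$ is an $s$-arborescence if $s\in U$ and every vertex of $U$ is reachable from $s$ by a unique directed path (a single vertex is allowed); $s$ is its root. Mixed hypergraphs: $\mathcal{E}$ is a collection of hyperedges and $\mathcal{A}$ of dyperedges (repetitions allowed). A hyperedge is a subset of $V$ with at least two elements. A dyperedge is an ordered pair $(Z,z)$, written $Zz$, with $z\in V$ (head) and $\emptyset\ne Z\subseteq V-z$ (tails). A hyperedge $Z$ enters $X\subseteq V$ if $Z\cap X\ne\emptyset\ne Z\cap\overline X$. A dyperedge $Zz$ enters $X$ if $z\in X$ and $Z\cap\overline X\neq\emptyset$. For a subpartition $\mathcal P$, $e_{\mathcal{E}\cup\mathcal{A}}(\mathcal{P})$ is the number of hyperedges in $\mathcal{E}$ and dyperedges in $\mathcal{A}$ that enter at least one member of $\mathcal{P}$.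 Orienting a hyperedge $Z$ means replacing it by the dyperedge $(Z-z)z$ for some $z\in Z$. Trimming a dyperedge $Zz$ means replacing it by an arc $yz$ for some $y\in Z$. Packings: a packing of arborescences in a digraph $D$ is a collection of pairwise arc-disjoint arborescences that are subgraphs of $D$ (several may be the same single vertex). It is $h$-regular if each vertex of $D$ belongs to exactly $h$ of them; $(f,g)$-bounded if for each $v$ the number of them rooted at $v$ is at least $f(v)$ and at most $g(v)$; $(\alpha,\beta)$-limited if their number is at least $\alpha$ and at most $\beta$; $\mathsf{M}$-independent-rooted if the multiset of roots forms an independent set of $\mathsf{M}$, i.e. there is an independent set $S^*\subseteq S$ of $\mathsf{M}$ such that for each $v$ the number of arborescences rooted at $v$ equals $|S^*_v|$. A mixed hypergraph has a packing of mixed hyperarborescences with some of these properties if all its hyperedges can be oriented and then all dyperedges trimmed so that the resulting digraph has a packing of arborescences with these properties. *)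

(* Defs.v *)
From mathcomp Require Import all_boot.

Set Implicit Arguments.
Unset Strict Implicit.
Unset Printing Implicit Defensive.

Definition weight (V : finType) (m : V -> nat) (X : {set V}) : nat :=
  \sum_(x in X) m x.

Definition truncate (V : finType) (g : V -> nat) (h : nat) : V -> nat :=
  fun v => minn (g v) h.

Definition subpartition (V : finType) (P : {set {set V}}) (Z : {set V}) : bool :=
  [&& trivIset P, set0 \notin P & cover P \subset Z].

Record matroid (S : finType) := Matroid {
  rank : {set S} -> nat;
  rank_subcard : forall X : {set S}, rank X <= #|X|;
  rank_mono : forall X Y : {set S}, X \subset Y -> rank X <= rank Y;
  rank_submod : forall X Y : {set S}, rank (X :&: Y) + rank (X :|: Y) <= rank X + rank Y
}.

Definition independent (S : finType) (M : matroid S) (X : {set S}) : bool :=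
  rank M X == #|X|.

(* A multiset of vertices is a finite type S of (distinct) copies together
   with the map at_ : S -> V sending each copy to its vertex, so that the
   multiplicity of v is the size of the fibre over v; copies at_ X is S_X. *)
Definition copies (V S : finType) (at_ : S -> V) (X : {set V}) : {set S} :=
  [set x | at_ x \in X].

(* Collections with repetitions are families indexed by a finite type. *)
Record digraph (V : finType) := Digraph {
  arc : finType;
  arc_tail : arc -> V;
  arc_head : arc -> V;
  arc_loopless : forall a, arc_tail a != arc_head a
}.

Record dypergraph (V : finType) := Dypergraph {
  dyperedge : finType;
  dy_tails : dyperedge -> {set V};
  dy_head : dyperedge -> V;
  dy_tails_neq0 : forall a, dy_tails a != set0;
  dy_headN : forall a, dy_head a \notin dy_tails a
}.

Record mixed_hypergraph (V : finType) := MixedHypergraph {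
  hyperedge : finType;
  hy_set : hyperedge -> {set V};
  hy_card : forall e, 1 < #|hy_set e|;
  dy_part :> dypergraph V
}.

Definition hy_enters (V : finType) (F : mixed_hypergraph V)
    (e : hyperedge F) (X : {set V}) : bool :=
  (hy_set e :&: X != set0) && (hy_set e :&: ~: X != set0).

Definition dy_enters (V : finType) (H : dypergraph V)
    (a : dyperedge H) (X : {set V}) : bool :=
  (dy_head a \in X) && (dy_tails a :&: ~: X != set0).

Definition entering (V : finType) (F : mixed_hypergraph V)
    (P : {set {set V}}) : nat :=
  #|[set e : hyperedge F | [exists X in P, hy_enters e X]]|
  + #|[set a : dyperedge F | [exists X in P, dy_enters a X]]|.

Section OrientTrim.
Variable V : finType.

Section Orient.
Variables (F : mixed_hypergraph V) (o : hyperedge F -> V).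
Hypothesis oP : forall e, o e \in hy_set e.

Definition orient_tails (x : hyperedge F + dyperedge F) : {set V} :=
  match x with inl e => hy_set e :\ o e | inr a => dy_tails a end.

Definition orient_head (x : hyperedge F + dyperedge F) : V :=
  match x with inl e => o e | inr a => dy_head a end.

Lemma orient_tails_neq0 x : orient_tails x != set0.
Proof.
case: x => [e|a] /=; last exact: dy_tails_neq0.
by have := hy_card e; rewrite (cardsD1 (o e)) oP -card_gt0.
Qed.

Lemma orient_headN x : orient_head x \notin orient_tails x.
Proof. by case: x => [e|a] /=; [rewrite setD11 | exact: dy_headN]. Qed.

Definition orient : dypergraph V :=
  Dypergraph orient_tails_neq0 orient_headN.

End Orient.

Section Trim.
Variables (H : dypergraph V) (t : dyperedge H -> V).
Hypothesis tP : forall a, t a \in dy_tails a.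

Lemma trim_loopless a : t a != dy_head a.
Proof. by apply: contraTneq (tP a) => ->; exact: dy_headN. Qed.

Definition trim : digraph V := Digraph trim_loopless.

End Trim.
End OrientTrim.

(* p is a sequence of consecutive arcs leading from u to v. *)
Fixpoint dipath (V : finType) (D : digraph V) (u : V) (p : seq (arc D)) (v : V)
    : bool :=
  if p is a :: q then (arc_tail a == u) && dipath (arc_head a) q v else u == v.

(* Paths are not required a priori to be vertex-simple: uniqueness among all
   of them forces simplicity, and excludes arcs that enter s or lead back to an
   ancestor, so that the root of an arborescence is determined by (U, B). *)
Definition is_arborescence (V : finType) (D : digraph V)
    (s : V) (U : {set V}) (B : {set arc D}) : Prop :=
  [/\ s \in U,
      forall a, a \in B -> (arc_tail a \in U) && (arc_head a \in U)
    & forall v, v \in U ->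
        exists! p : seq (arc D), all (mem B) p && dipath s p v].

Record arborescence (V : finType) (D : digraph V) := Arborescence {
  root_of : V;
  verts_of : {set V};
  arcs_of : {set arc D};
  arborescenceP : is_arborescence root_of verts_of arcs_of
}.

Section Packing.
Variables (V : finType) (D : digraph V).
Implicit Type P : seq (arborescence D).

(* The order of the sequence is irrelevant; a trivial (arcless) arborescence
   may occur several times in it. *)
Definition packing P : bool :=
  pairwise (fun T1 T2 => [disjoint arcs_of T1 & arcs_of T2]) P.

Definition rooted_at P (v : V) : nat := count (fun T => root_of T == v) P.

Definition regular (h : nat) P : Prop :=
  forall v, count (fun T => v \in verts_of T) P = h.

Definition bounded (f g : V -> nat) P : Prop :=
  forall v, f v <= rooted_at P v <= g v.

Definition limited (alpha beta : nat) P : Prop := alpha <= size P <= beta.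

Definition independent_rooted (S : finType) (at_ : S -> V) (M : matroid S) P
    : Prop :=
  exists2 I : {set S}, independent M I
    & forall v, rooted_at P v = #|I :&: copies at_ [set v]|.

End Packing.

Definition has_hyperpacking (V : finType) (F : mixed_hypergraph V)
    (property : forall D : digraph V, seq (arborescence D) -> Prop) : Prop :=
  exists (o : hyperedge F -> V) (oP : forall e, o e \in hy_set e)
         (t : dyperedge (orient oP) -> V) (tP : forall a, t a \in dy_tails a)
         (P : seq (arborescence (trim tP))),
    packing P /\ property (trim tP) P.

(* Main.v *)
Require Import Defs.
From mathcomp Require Import all_boot all_order all_algebra.
From mathcomp Require Import zify.
Set Implicit Arguments.
Unset Strict Implicit.
Unset Printing Implicit Defensive.
Import Order.TTheory GRing.Theory Num.Theory.
Local Open Scope ring_scope.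

(* Only the numbers m v of arborescences rooted at v, the heads of the
   hyperedges and the tails of the dyperedges have to be found.

   Write p(X) = i(X) + h - d(X), where i counts the hyperedges contained in X and
   d the dyperedges entering X, let q(U) be the maximum of the sum of p over a
   partition of U, and t(U) the number of hyperedges meeting U.  Since
   e(P) = t(U) - (sum of i over P) + (sum of d over P) for a partition P of U,
   condition (iv) bounds the supermodular function q - t from above, and the
   discrete sandwich theorem, applied to q - t corrected by f and to the rank
   function corrected by g_h, yields m with q <= m + t.  The sandwich theorem
   applied once per hyperedge splits t into heads, so that q(X) is at most m(X)
   plus the number of heads in X; then h <= m(X) + (number of dyperedges entering
   X) for every nonempty X.  This cut condition survives trimming by uncrossing
   tight sets, and Lovasz's proof of Edmonds' disjoint arborescences theorem gives
   the packing.  An independent set with multiplicities m is again a sandwiched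
   modular function, this time on the ground set of the matroid. *)

Lemma Posz_sum (I : Type) (s : seq I) (P : pred I) (F : I -> nat) :
  (\sum_(i <- s | P i) F i)%N%:Z = \sum_(i <- s | P i) (F i)%:Z.
Proof. exact: (big_morph Posz PoszD erefl). Qed.

(** * Supermodular set functions and the discrete sandwich theorem *)

Section SetFunctions.
Variable T : finType.
Implicit Types (X Y U W : {set T}) (p q : {set T} -> int).

Definition supermodular p :=
  forall X Y, p X + p Y <= p (X :&: Y) + p (X :|: Y).

Lemma supermodularD p q :
  supermodular p -> supermodular q -> supermodular (fun X => p X + q X).
Proof. by move=> sp sq X Y /=; have := sp X Y; have := sq X Y; lia. Qed.

Lemma supermodular_sum (I : Type) (s : seq I) (F : I -> {set T} -> int) :
  (forall i, supermodular (F i)) -> supermodular (fun X => \sum_(i <- s) F i X).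
Proof.
move=> sF X Y /=; elim: s => [|i s IHs]; first by rewrite !big_nil.
by rewrite !big_cons; have := sF i X Y; lia.
Qed.

Lemma sumID (m : T -> int) X Y :
  \sum_(x in X :&: Y) m x + \sum_(x in X :|: Y) m x =
  \sum_(x in X) m x + \sum_(x in Y) m x.
Proof.
rewrite ![\sum_(x in _) _]big_mkcond -!big_split /=.
by apply: eq_bigr => x _; rewrite !inE; case: (x \in X); case: (x \in Y) => /=; lia.
Qed.

Lemma supermodular_modular (m : T -> int) :
  supermodular (fun X => \sum_(x in X) m x).
Proof. by move=> X Y /=; rewrite sumID. Qed.

Lemma supermodular_modularN (m : T -> int) :
  supermodular (fun X => - \sum_(x in X) m x).
Proof. by move=> X Y /=; rewrite -!opprD sumID. Qed.

(** The whole set is an intersection only of two copies of itself, so raising its value never spoils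
    an inequality. Later this prescribes the total of a sandwiched function. *)
Lemma supermodular_raiseT p (k : int) :
  supermodular p -> p setT <= k ->
  supermodular (fun X => if X == setT then k else p X).
Proof.
move=> sp pk X Y /=.
have [->|XT] := eqVneq X setT; first by rewrite setTI setTU eqxx; case: ifP => _; lia.
have [->|YT] := eqVneq Y setT.
  by rewrite setIT setUT eqxx (negPf XT); lia.
have /negPf-> : X :&: Y != setT.
  by apply: contraNneq XT => E; rewrite -subTset -E subsetIl.
by have := sp X Y; case: eqP => [->|_]; lia.
Qed.

(* Fourier-Motzkin elimination of v once the value t of the modular function
   at v is fixed. *)
Definition fix_value p (v : T) (t : int) X : int :=
  Num.max (p (X :\ v)) (p (v |: X) - t).

Lemma fix_valueP p v t X :
  [/\ p (X :\ v) <= fix_value p v t X, p (v |: X) - t <= fix_value p v t X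
    & fix_value p v t X = p (X :\ v) \/ fix_value p v t X = p (v |: X) - t].
Proof. by rewrite /fix_value; split; lia. Qed.

Lemma setD1IU1 (v : T) X Y : (X :\ v) :&: (v |: Y) = (X :&: Y) :\ v.
Proof. by apply/setP => x; rewrite !inE; case: eqP. Qed.

Lemma setD1UU1 (v : T) X Y : X :\ v :|: (v |: Y) = v |: (X :|: Y).
Proof. by apply/setP => x; rewrite !inE; case: eqP; rewrite ?orbT. Qed.

(** Each maximum on the left is attained with [v] deleted or with [v] added. In the mixed case
    [X :\ v] and [v |: Y] meet in [(X :&: Y) :\ v] and unite to [v |: (X :|: Y)], so one inequality
    for [p] suffices and [t] occurs once on each side. *)
Lemma fix_value_supermodular p v t : supermodular p -> supermodular (fix_value p v t).
Proof.
move=> sp X Y.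
have [i1 i2 _] := fix_valueP p v t (X :&: Y).
have [u1 u2 _] := fix_valueP p v t (X :|: Y).
have [_ _ [->|->]] := fix_valueP p v t X; have [_ _ [->|->]] := fix_valueP p v t Y.
- have := sp (X :\ v) (Y :\ v); rewrite -setDIl -setDUl; lia.
- have := sp (X :\ v) (v |: Y).
  rewrite setD1IU1 setD1UU1.
  lia.
- have := sp (v |: X) (Y :\ v).
  rewrite [_ :&: _]setIC [_ :|: Y :\ v]setUC setD1IU1 setD1UU1 (setIC Y) (setUC Y).
  lia.
- by have := sp (v |: X) (v |: Y); rewrite -setUIr -setUUr; lia.
Qed.

Lemma argmaxE (I : finType) (i0 : I) (P : pred I) (F : I -> int) :
  P i0 -> exists2 i, P i & forall j, P j -> F j <= F i.
Proof. by move=> Pi0; case: (arg_maxP F Pi0) => i Pi leF; exists i. Qed.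

Lemma sandwich_on U p (c : {set T} -> int) :
  supermodular p -> supermodular c -> (forall X, p X + c X <= 0) ->
  p set0 = 0 -> c set0 = 0 ->
  (forall X, p X = p (X :&: U)) -> (forall X, c X = c (X :&: U)) ->
  exists m : T -> int,
    forall X, p X <= \sum_(x in X) m x /\ c X <= - \sum_(x in X) m x.
Proof.
elim: {U}_.+1 {-2}U (ltnSn #|U|) p c => // n IHn U ltUn p c sp sc pc p0 c0 pU cU.
have [U0|[v vU]] := set_0Vmem U.
  exists (fun=> 0) => X; rewrite big1 // pU cU U0 setI0 p0 c0; split; lia.
have [X0 _ X0max] := argmaxE (fun X => p (v |: X) + c (X :\ v)) (erefl : predT set0).
(* The best lower bound on the value at [v]: any solution has [m v] at least [p (v |: X)] minus the
   sum over [X :\ v], and that sum is at most [- c (X :\ v)]. *)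
set t := p (v |: X0) + c (X0 :\ v) in X0max.
(* [t] also respects every upper bound on the value at [v]: uncross for [p] and for [c], then use
   [p + c <= 0] on the resulting intersection and union. *)
have tU Y : c (v |: Y) + t <= - p (Y :\ v).
  have := sp (v |: X0) (Y :\ v); have := sc (X0 :\ v) (v |: Y).
  rewrite [(v |: X0) :&: _]setIC [(v |: X0) :|: _]setUC.
  rewrite !setD1IU1 !setD1UU1 (setIC Y) (setUC Y).
  have := pc ((X0 :&: Y) :\ v); have := pc (v |: (X0 :|: Y)).
  by rewrite /t; lia.
have fixU q : (forall X, q X = q (X :&: U)) ->
    forall s X, fix_value q v s X = fix_value q v s (X :&: (U :\ v)).
  move=> qU s X; rewrite /fix_value; congr (Num.max _ (_ - _)).
    rewrite qU [in RHS]qU; congr q; apply/setP=> x; rewrite !inE.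
    by case: eqP; rewrite /= ?andbF //; case: (x \in X); case: (x \in U).
  rewrite qU [RHS]qU; congr q; apply/setP=> x; rewrite !inE.
  by case: eqP => //=; case: (x \in X); case: (x \in U).
have fix0 q s : q set0 = 0 -> q [set v] <= s -> fix_value q v s set0 = 0.
  by move=> q0 qs; rewrite /fix_value set0D setU0 q0; lia.
have [||||||||m mP] := IHn (U :\ v) _ (fix_value p v t) (fix_value c v (- t)).
- by move: ltUn; rewrite (cardsD1 v U) vU.
- exact: fix_value_supermodular.
- exact: fix_value_supermodular.
- move=> X; have := tU X; have := X0max X isT; have := pc (X :\ v); have := pc (v |: X).
  by rewrite /fix_value; lia.
- by apply: fix0 => //; have := X0max set0 isT; rewrite setU0 set0D c0; lia.
- by apply: fix0 => //; have := tU set0; rewrite setU0 set0D p0; lia.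
- exact: fixU.
- exact: fixU.
exists (fun x => if x == v then t else m x) => X.
have mX : \sum_(x in X :\ v) (if x == v then t else m x) = \sum_(x in X :\ v) m x.
  by apply: eq_bigr => x; rewrite !inE => /andP[/negPf->].
have [p1 p2 _] := fix_valueP p v t (X :\ v).
have [c1 c2 _] := fix_valueP c v (- t) (X :\ v).
have [] := mP (X :\ v).
have [vX|vX] := boolP (v \in X).
  rewrite (big_setD1 v vX) /= eqxx mX; move: p2 c2; rewrite setD1K //.
  by move: (\sum_(x in _) m x) => s; lia.
have XE : X :\ v = X by apply/setDidPl; rewrite disjoint_sym disjoints1.
by rewrite !XE in p1 c1 mX *; rewrite mX; move: (\sum_(x in _) m x) => s; lia.
Qed.

Lemma sandwich p (c : {set T} -> int) :
  supermodular p -> supermodular c -> (forall X, p X + c X <= 0) ->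
  p set0 = 0 -> c set0 = 0 ->
  exists m : T -> int,
    forall X, p X <= \sum_(x in X) m x /\ c X <= - \sum_(x in X) m x.
Proof.
by move=> sp sc pc p0 c0; apply: (@sandwich_on setT) => // X; rewrite setIT.
Qed.

(** [q X] is the maximum of [p] over the subsets of [X]. The intersection and union of maximizers
    for [X] and [Y] are candidates for [X :&: Y] and [X :|: Y]. *)
Lemma monotone_closure p :
  supermodular p -> exists q, [/\ supermodular q,
    forall X, exists2 Z : {set T}, Z \subset X & q X = p Z
  & forall X (Z : {set T}), Z \subset X -> p Z <= q X].
Proof.
move=> sp.
have max X : exists Z : {set T}, (Z \subset X) &&
    [forall (Y : {set T} | Y \subset X), p Y <= p Z].
  have [Z ZX Zmax] := @argmaxE _ X (fun Z : {set T} => Z \subset X) p (subxx X).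
  by exists Z; rewrite ZX; apply/forall_inP.
pose a X := xchoose (max X).
have aP X : a X \subset X /\ forall Z : {set T}, Z \subset X -> p Z <= p (a X).
  by have /andP[aX /forall_inP] := xchooseP (max X).
exists (p \o a); split=> [X Y|X|X Z] /=; last by move=> /(proj2 (aP X)).
  have [aX _] := aP X; have [aY _] := aP Y.
  have := (aP (X :&: Y)).2 _ (setISS aX aY); have := (aP (X :|: Y)).2 _ (setUSS aX aY).
  by have := sp (a X) (a Y); lia.
by exists (a X); first exact: (aP X).1.
Qed.

(** * Upper truncation of a supermodular function: maximization over partitions *)

Section Truncation.
Variable p : {set T} -> int.

(* c is the total of p over the blocks of some partition of U. *)
Inductive partition_value : {set T} -> int -> Prop :=
| PartitionValue0 : partition_value set0 0
| PartitionValueU X U (c : int) : X != set0 -> [disjoint X & U] ->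
    partition_value U c -> partition_value (X :|: U) (p X + c).

Lemma partition_valueP U c : partition_value U c ->
  exists2 P : {set {set T}}, partition P U & c = \sum_(X in P) p X.
Proof.
elim=> {U c} [|X U c X0 XU _ [P PU ->]].
  by exists set0; rewrite ?big_set0 // partition_set0.
have XP : X \notin P.
  apply: contraNN X0 => /(partitionS PU)/setIidPl <-.
  by rewrite (disjoint_setI0 XU).
by exists (X |: P); [exact: partitionU1 | rewrite big_setU1].
Qed.

Lemma partition_value1 X : X != set0 -> partition_value X (p X).
Proof.
move=> X0; have := PartitionValueU X0 _ PartitionValue0.
by rewrite setU0 addr0; apply; rewrite -setI_eq0 setI0.
Qed.

Lemma partition_value_disjU U W c d : [disjoint U & W] ->
  partition_value U c -> partition_value W d -> partition_value (U :|: W) (c + d).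
Proof.
move=> + cU dW; elim: cU => {U c} [_|X U c X0 XU cU IH].
  by rewrite set0U add0r.
rewrite -!setI_eq0 setIUl setU_eq0 => /andP[XW UW].
rewrite -setUA -addrA; apply: PartitionValueU => //.
  by rewrite -setI_eq0 setIUr setU_eq0 XW setI_eq0 XU.
by apply: IH; rewrite -setI_eq0.
Qed.

Hypothesis sp : supermodular p.

(** [X] runs through the blocks of [U]. A block disjoint from [X] goes to the partition of the
    union; a block [Y] meeting [X] leaves [Y :&: X] to the partition of the intersection, and
    [X :|: Y] runs on. *)
Lemma partition_value_uncross1 U c X : X != set0 -> partition_value U c ->
  exists d e, [/\ partition_value (U :|: X) d, partition_value (U :&: X) e
    & c + p X <= d + e].
Proof.
move=> + cU; elim: cU X => {U c} [|Y U c Y0 YU cU IH] X X0.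
  exists (p X), 0; rewrite set0U set0I; split; last lia.
    exact: partition_value1.
  exact: PartitionValue0.
have [XY|XY] := boolP [disjoint Y & X].
  have [d [e [dU eU ce]]] := IH X X0.
  exists (p Y + d), e; split; last lia.
    rewrite -setUA; apply: PartitionValueU => //.
    by rewrite -setI_eq0 setIUr setU_eq0 !setI_eq0 YU.
  by rewrite setIUl (disjoint_setI0 XY) set0U.
have [|d [e [dU eU ce]]] := IH (X :|: Y); first by rewrite setU_eq0 negb_and X0.
exists d, (p (Y :&: X) + e); split.
- by rewrite -setUA setUC -setUA.
- rewrite setIUl; apply: PartitionValueU; first by rewrite setI_eq0.
    by apply: disjointW YU; rewrite subsetIl.
  rewrite (_ : U :&: X = U :&: (X :|: Y)) // setIUr [U :&: Y]setIC (disjoint_setI0 YU).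
  by rewrite setU0.
- by have := sp X Y; rewrite setIC; lia.
Qed.

(** The blocks of [W] are absorbed one at a time; what they cut off from [U] stays disjoint because
    they are disjoint. *)
Lemma partition_value_uncross U W c d :
  partition_value U c -> partition_value W d ->
  exists c' d', [/\ partition_value (U :|: W) c', partition_value (U :&: W) d'
    & c + d <= c' + d'].
Proof.
move=> + dW; elim: dW U c => {W d} [|X W d X0 XW dW IH] U c cU.
  exists c, 0; rewrite setU0 setI0; split; [by []|exact: PartitionValue0|lia].
have [c1 [c2 [c1U c2U le1]]] := partition_value_uncross1 X0 cU.
have [e1 [e2 [e1U e2U le2]]] := IH _ _ c1U.
exists e1, (c2 + e2); split; [by rewrite setUA | | lia].
rewrite setIUr; apply: partition_value_disjU => //.
  by apply: disjointW XW; rewrite subsetIr.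
by rewrite setIUl (disjoint_setI0 XW) setU0 in e2U.
Qed.

Lemma partition_value_sum U (P : {set {set T}}) :
  partition P U -> partition_value U (\sum_(X in P) p X).
Proof.
elim: {P}_.+1 {-2}P U (ltnSn #|P|) => // n IHn P U ltP PU.
have [P0|[X XP]] := set_0Vmem P.
  by rewrite -(cover_partition PU) P0 /cover !big_set0; exact: PartitionValue0.
rewrite (big_setD1 X XP) /= -(setID U X) (setIidPr (partitionS PU XP)).
apply: PartitionValueU; first exact: partition_neq0 PU XP.
  by rewrite disjoint_sym disjoints_subset setDE subsetIr.
by apply: IHn (partitionD1 PU XP); move: ltP; rewrite (cardsD1 X P) XP.
Qed.

(** Supermodularity is the uncrossing of two optimal partitions. The empty set has only the empty
    partition, so [q set0 = 0] whatever [p set0] is. *)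
Lemma truncation : exists q : {set T} -> int,
  [/\ supermodular q, q set0 = 0,
      forall X, X != set0 -> p X <= q X
    & forall U, exists2 P, partition P U & q U = \sum_(X in P) p X].
Proof.
have value U : exists c, partition_value U c.
  have [->|U0] := eqVneq U set0; first by exists 0; exact: PartitionValue0.
  by exists (p U); apply: partition_value1.
have max U : exists P, partition P U &&
    [forall (Q | partition Q U), \sum_(X in Q) p X <= \sum_(X in P) p X].
  have [c /partition_valueP[P0 bP0 _]] := value U.
  have [P bP Pmax] := @argmaxE _ P0 (fun P => partition P U)
    (fun P : {set {set T}} => \sum_(X in P) p X) bP0.
  by exists P; rewrite bP; apply/forall_inP.
pose q U := \sum_(X in xchoose (max U)) p X.
have qb U : partition (xchoose (max U)) U by case/andP: (xchooseP (max U)).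
have qmax U c : partition_value U c -> c <= q U.
  by move=> /partition_valueP[P bP ->]; have /andP[_ /forall_inP] := xchooseP (max U); apply.
exists q; split.
- move=> U W.
  have [c [d [cU dW]]] := partition_value_uncross (partition_value_sum (qb U))
    (partition_value_sum (qb W)).
  rewrite -/(q U) -/(q W); have := qmax _ _ cU; have := qmax _ _ dW; lia.
- by have := qb set0; rewrite partition_set0 /q => /eqP->; rewrite big_set0.
- by move=> X X0; apply: qmax; apply: partition_value1.
- by move=> U; exists (xchoose (max U)).
Qed.

End Truncation.
End SetFunctions.

(** * Choosing heads of hyperedges and tails of dyperedges *)

Section HeadsAndTails.
Variable V : finType.
Implicit Types (X Y Z : {set V}).

Definition meets Z X : bool := Z :&: X != set0.
Definition enters Z (z : V) X : bool := (z \in X) && ~~ (Z \subset X).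

Lemma meets_submodular Z : supermodular (fun X => - (meets Z X : nat)%:Z).
Proof.
move=> X Y /=.
have -> : meets Z (X :|: Y) = meets Z X || meets Z Y.
  by rewrite /meets setIUr setU_eq0 negb_and.
have : meets Z (X :&: Y) ==> meets Z X && meets Z Y.
  apply/implyP=> /set0Pn[x]; rewrite !inE => /and3P[xZ xX xY].
  by apply/andP; split; apply/set0Pn; exists x; rewrite inE xZ.
by case: (meets Z X); case: (meets Z Y); case: (meets Z (X :&: Y)).
Qed.

Lemma contained_supermodular Z : supermodular (fun X => (Z \subset X : nat)%:Z).
Proof.
move=> X Y /=; rewrite subsetI.
have : (Z \subset X) || (Z \subset Y) ==> (Z \subset X :|: Y).
  by apply/implyP => /orP[] /subset_trans -> //; rewrite ?subsetUl ?subsetUr.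
by case: (Z \subset X); case: (Z \subset Y); case: (Z \subset X :|: Y).
Qed.

Lemma enters_submodular Z z : supermodular (fun X => - (enters Z z X : nat)%:Z).
Proof.
move=> X Y /=; have := contained_supermodular Z X Y.
rewrite /enters !inE; rewrite subsetI.
have : (Z \subset X) || (Z \subset Y) ==> (Z \subset X :|: Y).
  by apply/implyP => /orP[] /subset_trans -> //; rewrite ?subsetUl ?subsetUr.
by case: (z \in X); case: (z \in Y); case: (Z \subset X); case: (Z \subset Y);
  case: (Z \subset X :|: Y).
Qed.

(** The share of [q] that [e] must cover is sandwiched by an integral function [x] of total 1 lying
    below [meets (Z e)]. Such an [x] is dominated by the indicator of one vertex of [Z e], which
    becomes the head; induction then handles [q] minus [x]. *)
Lemma orient_supermodular (E : eqType) (s : seq E) (Z : E -> {set V}) q :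
  uniq s -> (forall e, Z e != set0) -> supermodular q -> q set0 = 0 ->
  (forall X, q X <= \sum_(e <- s) (meets (Z e) X : nat)%:Z) ->
  exists2 o : E -> V, (forall e, o e \in Z e)
    & forall X, q X <= \sum_(e <- s) (o e \in X : nat)%:Z.
Proof.
move=> + Z0; elim: s q => [|e s IHs] q /=.
  move=> _ sq q0 qle; have ne e := set0Pn _ (Z0 e).
  exists (fun e => xchoose (ne e)) => [e|X]; first exact: xchooseP.
  by have := qle X; rewrite !big_nil.
move=> /andP[es us] sq q0 qle.
pose t X : int := \sum_(e <- s) (meets (Z e) X : nat)%:Z.
have st : supermodular (fun X => - t X).
  have := supermodular_sum s (fun e => meets_submodular (Z e)).
  by move=> H X Y; rewrite /t -!sumrN; apply: H.
have qle1 X : q X <= (meets (Z e) X : nat)%:Z + t X.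
  by have := qle X; rewrite big_cons.
have m0 Y : meets Y set0 = false by rewrite /meets setI0 eqxx.
have mT : meets (Z e) setT by rewrite /meets setIT.
have t0 : t set0 = 0 by rewrite /t big1 // => f _; rewrite m0.
have T0 : set0 != setT :> {set V}.
  by apply: contraNneq (Z0 e) => T0; rewrite -subset0 T0 subsetT.
have sqt := supermodularD sq st.
(* The value 1 on [setT] forces the total of [x] to be 1, so that [x] is positive somewhere. *)
have [||||| x xP] := @sandwich _ (fun X => if X == setT then 1 else q X - t X)
  (fun X => - (meets (Z e) X : nat)%:Z).
- apply: (supermodular_raiseT (p := fun X => q X - t X)) => //.
  by have := qle1 setT; rewrite mT; lia.
- exact: meets_submodular.
- by move=> X /=; case: eqP => [->|_]; [rewrite mT | have := qle1 X; lia].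
- by rewrite (negPf T0) q0 t0.
- by rewrite m0.
have xle X : \sum_(v in X) x v <= (meets (Z e) X : nat)%:Z.
  by have [_] := xP X; rewrite lerN2.
have xge X : q X - t X <= \sum_(v in X) x v.
  have [+ _] := xP X; case: eqP => [->|//] le1.
  by apply: le_trans le1; have := qle1 setT; rewrite mT; lia.
have [v xv] : exists v, 0 < x v.
  apply/existsP; rewrite -[X in is_true X]negbK negb_exists.
  apply/negP => /forallP x0; have [+ _] := xP setT; rewrite eqxx leNgt => /negP; apply.
  apply: le_lt_trans (_ : 0 < 1) => //; apply: sumr_le0 => v _.
  by rewrite leNgt.
have vZ : v \in Z e.
  have := xle [set v]; rewrite big_set1 => /(lt_le_trans xv).
  by case: (boolP (meets _ _)) => // /set0Pn[u]; rewrite !inE => /andP[+ /eqP<-].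
(* If [v] is outside [X], adding it raises the sum by at least 1 while the bound 1 still holds, so
   the sum over [X] was at most 0. *)
have xv1 X : \sum_(u in X) x u <= (v \in X : nat)%:Z.
  have le1 Y : \sum_(u in Y) x u <= 1 by apply: le_trans (xle Y) _; case: meets.
  case: (boolP (v \in X)) => vX; first exact: le1.
  have := le1 (v |: X); rewrite big_setU1 //=; move: (\sum_(u in X) x u) => y; lia.
have [||||o oP oq] := IHs (fun X => q X - \sum_(u in X) x u).
- by [].
- exact: supermodularD (supermodular_modularN x).
- by rewrite q0 big_set0.
- by move=> X; have := xge X; rewrite -/(t X); move: (\sum_(u in X) x u) => y; lia.
exists (fun f => if f == e then v else o f) => [f|X]; first by case: eqP => [->|].
rewrite big_cons eqxx.
rewrite (eq_big_seq (fun f => (o f \in X : nat)%:Z)); last first.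
  by move=> f fs; case: eqP => // fe; rewrite fe (negPf es) in fs.
have := oq X; have := xv1 X; move: (\sum_(u in X) x u) (\sum_(f <- s) _) => y z; lia.
Qed.

(* The sets violating the bound when the head z keeps only a tail y are closed
   under union, so their union would contain the whole of Z. *)
Lemma trim1 (w : {set V} -> int) (h : int) Z z :
  supermodular (fun X => - w X) -> Z != set0 ->
  (forall X, X != set0 -> h <= w X + (enters Z z X : nat)%:Z) ->
  exists2 y, y \in Z
    & forall X, X != set0 -> h <= w X + (enters [set y] z X : nat)%:Z.
Proof.
move=> sw Z0 wle; pose bad X := (z \in X) && (w X < h).
(* Both sets contain [z], so their intersection is nonempty and has [w] at least [h - 1], whereas
   bad sets have [w] at most [h - 1]. *)
have badU X Y : bad X -> bad Y -> bad (X :|: Y).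
  move=> /andP[zX wX] /andP[zY wY]; rewrite /bad !inE zX /=.
  have := wle (X :&: Y); have := sw X Y.
  have -> : X :&: Y != set0 by apply/set0Pn; exists z; rewrite inE zX.
  by case: enters => + /(_ isT); lia.
have [y yP|none] := pickP [pred y in Z | [forall X, (X != set0) ==>
    (h <= w X + (enters [set y] z X : nat)%:Z)]].
  by case/andP: yP => yZ /forallP yP; exists y => // X; apply/implyP.
have badZ y : y \in Z -> exists2 X, bad X & y \in X.
  move=> yZ; have := none y; rewrite /= yZ /= => /negbT; rewrite negb_forall.
  case/existsP => X; rewrite negb_imply -ltNge => /andP[X0 wX].
  have := wle X X0; move: wX; rewrite /enters sub1set.
  case: (boolP (z \in X)) => zX /=.
  2: by move=> wX hw; have := lt_le_trans wX hw; rewrite ltxx.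
  case: (boolP (y \in X)) => yX /= wX; last by case: (_ \subset _) => /= hw; lia.
  by exists X => //; rewrite /bad zX /=; move: wX; rewrite addr0.
have /set0Pn[y0 y0Z] := Z0; have [X0 bX0 _] := badZ y0 y0Z.
pose U := \bigcup_(X | bad X) X.
have bU : bad U.
  rewrite /U (bigD1 X0) //=; elim/big_rec: _ => [|X Y /andP[bX _] bY]; first by rewrite setU0.
  by rewrite setUCA; apply: badU.
have ZU : Z \subset U.
  by apply/subsetP => y /badZ[X bX yX]; apply/bigcupP; exists X.
case/andP: bU => zU; have := wle U; rewrite /enters ZU andbF addr0.
by rewrite ltNge => -> //; apply/set0Pn; exists z.
Qed.

(** Dyperedges are trimmed one by one. Arcs already chosen are absorbed into [w], and for each
    single step the dyperedges still to be trimmed are added to it; both additions keep [w]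
    submodular. *)
Lemma trim_all (D : eqType) (s : seq D) (Z : D -> {set V}) (z : D -> V)
    (w : {set V} -> int) (h : int) :
  uniq s -> (forall a, Z a != set0) -> supermodular (fun X => - w X) ->
  (forall X, X != set0 -> h <= w X + \sum_(a <- s) (enters (Z a) (z a) X : nat)%:Z) ->
  exists2 t : D -> V, (forall a, t a \in Z a)
    & forall X, X != set0 ->
        h <= w X + \sum_(a <- s) (enters [set t a] (z a) X : nat)%:Z.
Proof.
move=> + Z0; elim: s w => [|a s IHs] w /=.
  move=> _ sw wle; have ne a := set0Pn _ (Z0 a).
  exists (fun a => xchoose (ne a)) => [a|X]; first exact: xchooseP.
  by rewrite big_nil => /wle; rewrite big_nil.
move=> /andP[as_ us] sw wle.
pose r X : int := \sum_(b <- s) (enters (Z b) (z b) X : nat)%:Z.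
have sr : supermodular (fun X => - r X).
  have := supermodular_sum s (fun b => enters_submodular (Z b) (z b)).
  by move=> H X Y; rewrite /r -!sumrN; apply: H.
have [|||y yZ yP] := @trim1 (fun X => w X + r X) h (Z a) (z a).
- by move=> X Y /=; have := sw X Y; have := sr X Y; lia.
- exact: Z0.
- by move=> X /wle; rewrite big_cons -/(r X); lia.
have [||t tP tle] := IHs (fun X => w X + (enters [set y] (z a) X : nat)%:Z) us.
- by move=> X Y /=; have := sw X Y; have := enters_submodular [set y] (z a) X Y; lia.
- by move=> X /yP; rewrite -/(r X); lia.
exists (fun b => if b == a then y else t b) => [b|X X0]; first by case: eqP => [->|].
rewrite big_cons eqxx (eq_big_seq (fun b => (enters [set t b] (z b) X : nat)%:Z)); last first.
  by move=> b bs; case: eqP => // ba; rewrite ba (negPf as_) in bs.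
by have := tle X X0; rewrite addrA.
Qed.
End HeadsAndTails.

(** * The sandwich theorem with bounds on single values and on the total *)

Section BoundedSandwich.
Variable V : finType.
Implicit Types X Y Z W : {set V}.

Lemma sum_setD (m : V -> int) Z W : Z \subset W ->
  \sum_(v in W :\: Z) m v = \sum_(v in W) m v - \sum_(v in Z) m v.
Proof.
by move=> /setIidPr ZW; rewrite [\sum_(v in W) _](big_setID Z) /= ZW addrC addrK.
Qed.

Lemma sum_diff_le (f g : V -> int) X Z W : (forall v, f v <= g v) ->
  X \subset W -> Z \subset W ->
  \sum_(v in W :\: Z) f v + \sum_(v in Z :\: X) g v <=
  \sum_(v in W :\: X) g v + \sum_(v in X :\: Z) f v.
Proof.
move=> fg XW ZW; rewrite ![\sum_(v in _) _]big_mkcond -!big_split /=.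
apply: ler_sum => v _; rewrite !inE.
move/subsetP: XW => /(_ v); move/subsetP: ZW => /(_ v); have := fg v.
case: (v \in X) => [] /=; case: (v \in Z) => [] /=; case: (v \in W) => //=; lia.
Qed.

(** Together [q] and [f] force at least the maximum of [q Z] plus the sum of [f] over [X :\: Z], for
    [Z \subset X]; [r] and [g] bound from above symmetrically. These combined bounds are again
    super- and submodular, so the plain sandwich theorem applies. *)
Lemma bounded_sandwich (q r : {set V} -> int) (f g : V -> int) (alpha beta : int) :
  [set: V] != set0 -> supermodular q -> supermodular (fun X => - r X) ->
  q set0 = 0 -> r set0 = 0 -> (forall v, f v <= g v) -> alpha <= beta ->
  (forall X Z, q Z + \sum_(v in X :\: Z) f v <= r X + \sum_(v in Z :\: X) g v) ->
  (forall Z, q Z + \sum_(v in ~: Z) f v <= beta) ->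
  (forall X, alpha <= r X + \sum_(v in ~: X) g v) ->
  exists m : V -> int, [/\ forall v, f v <= m v <= g v,
    forall X, q X <= \sum_(v in X) m v <= r X
    & alpha <= \sum_v m v <= beta].
Proof.
move=> T0 sq sr q0 r0 fg ab qr qb ra.
(* Subtracting [f] before the closure and adding it back in [p1] yields the combined lower bound;
   [c1] is the negated combined upper bound. *)
have [p [sp pZ Zp]] := monotone_closure (supermodularD sq (supermodular_modularN f)).
have [c [sc cZ Zc]] := monotone_closure (supermodularD sr (supermodular_modular g)).
pose p1 X := p X + \sum_(v in X) f v.
pose c1 X := c X - \sum_(v in X) g v.
have p1_ge X Z : Z \subset X -> q Z + \sum_(v in X :\: Z) f v <= p1 X.
  move=> ZX; have := Zp _ _ ZX; rewrite /p1 sum_setD //.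
  by move: (\sum_(v in X) _) (\sum_(v in Z) _) => a b; lia.
have p1_eq X : exists2 Z : {set V}, Z \subset X & p1 X = q Z + \sum_(v in X :\: Z) f v.
  have [Z ZX pX] := pZ X; exists Z => //; rewrite /p1 pX sum_setD //.
  by move: (\sum_(v in X) _) (\sum_(v in Z) _) => a b; lia.
have c1_ge X Z : Z \subset X -> - r Z - \sum_(v in X :\: Z) g v <= c1 X.
  move=> ZX; have := Zc _ _ ZX; rewrite /c1 sum_setD //.
  by move: (\sum_(v in X) _) (\sum_(v in Z) _) => a b; lia.
have c1_eq X : exists2 Z : {set V}, Z \subset X & c1 X = - r Z - \sum_(v in X :\: Z) g v.
  have [Z ZX cX] := cZ X; exists Z => //; rewrite /c1 cX sum_setD //.
  by move: (\sum_(v in X) _) (\sum_(v in Z) _) => a b; lia.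
have pc W : p1 W + c1 W <= 0.
  have [Z ZW ->] := p1_eq W; have [X XW ->] := c1_eq W.
  have := qr X Z; have := sum_diff_le fg XW ZW.
  move: (\sum_(v in W :\: Z) _) (\sum_(v in Z :\: X) _) (\sum_(v in W :\: X) _) => a b d.
  by move: (\sum_(v in _) _) => e; lia.
(* The total that [m] will have: both bounds take the value [k] on the whole set, which [kb] and
   [kc] show to be admissible. *)
pose k := Num.max alpha (p1 setT).
have kb : k <= beta.
  rewrite ge_max ab; have [Z _ ->] := p1_eq setT; rewrite setTD; exact: qb.
have kc : c1 setT <= - k.
  have [X _ cX] := c1_eq setT; have := pc setT; rewrite cX setTD; have := ra X.
  by rewrite /k; move: (\sum_(v in _) _) => a; lia.
have p10 : p1 set0 = 0.
  by have [Z + ->] := p1_eq set0; rewrite subset0 => /eqP->; rewrite setDv big_set0 q0.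
have c10 : c1 set0 = 0.
  by have [Z + ->] := c1_eq set0; rewrite subset0 => /eqP->; rewrite setDv big_set0 r0 oppr0.
have nT0 : (set0 == setT :> {set V}) = false by rewrite eq_sym (negPf T0).
have [||||| m mP] := @sandwich _ (fun X => if X == setT then k else p1 X)
  (fun X => if X == setT then - k else c1 X).
- apply: supermodular_raiseT; first exact: supermodularD (supermodular_modular f).
  by rewrite le_max lexx orbT.
- by apply: supermodular_raiseT => //; apply: supermodularD (supermodular_modularN g).
- by move=> X; case: eqP => _; [rewrite subrr | exact: pc].
- by rewrite nT0.
- by rewrite nT0.
have m_ge X : p1 X <= \sum_(v in X) m v.
  have [+ _] := mP X; case: eqP => [->|//] km.
  by apply: le_trans km; rewrite le_max lexx orbT.
have m_le X : c1 X <= - \sum_(v in X) m v.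
  have [_] := mP X; case: eqP => [->|//] km.
  exact: le_trans kc km.
have mT : \sum_v m v = k.
  have [] := mP setT; rewrite eqxx (eq_bigl predT) => [|v]; last by rewrite inE.
  by move: (\sum_v _) => a; lia.
exists m; split.
- move=> v; have := m_ge [set v]; have := m_le [set v]; rewrite !big_set1.
  have := p1_ge [set v] set0 (sub0set _); have := c1_ge [set v] set0 (sub0set _).
  by rewrite setD0 !big_set1 q0 r0; lia.
- move=> X; have := m_ge X; have := m_le X.
  have := p1_ge X X (subxx _); have := c1_ge X X (subxx _).
  by rewrite setDv !big_set0; move: (\sum_(v in _) _) => a; lia.
- by rewrite mT kb le_max lexx.
Qed.

End BoundedSandwich.

(** * Independent sets with prescribed multiplicities *)

Section Rado.
Variables (V S : finType) (at_ : S -> V) (M : matroid S).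

Lemma rank0 : rank M set0 = 0%N.
Proof. by apply/eqP; rewrite -leqn0 -[X in (_ <= X)%N](cards0 S) rank_subcard. Qed.

Lemma independent_card (I Y : {set S}) : independent M I -> (#|I :&: Y| <= rank M Y)%N.
Proof.
move=> /eqP indI; have := rank_submod M (I :&: Y) (I :\: Y).
rewrite setID indI -(cardsID Y I); have := rank_subcard M (I :\: Y).
by have := rank_mono M (subsetIr I Y); lia.
Qed.

Lemma rank_supermodularN : supermodular (fun Y => - (rank M Y)%:Z).
Proof. by move=> X Y /=; have := rank_submod M X Y; lia. Qed.

Lemma copiesI X Y : copies at_ (X :&: Y) = copies at_ X :&: copies at_ Y.
Proof. by apply/setP => s; rewrite !inE. Qed.

Lemma copiesU X Y : copies at_ (X :|: Y) = copies at_ X :|: copies at_ Y.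
Proof. by apply/setP => s; rewrite !inE. Qed.

Lemma card_copies (I : {set S}) (X : {set V}) :
  (\sum_(v in X) #|I :&: copies at_ [set v]| = #|I :&: copies at_ X|)%N.
Proof.
under eq_bigr => v _ do rewrite -sum1_card.
rewrite -sum1_card (partition_big at_ (mem X)) /=; last by move=> s; rewrite !inE => /andP[].
apply: eq_bigr => v vX; apply: eq_bigl => s; rewrite !inE.
by case: eqP => [->|]; rewrite ?vX ?andbT ?andbF.
Qed.

(** The sandwich theorem on [S], between the rank and the total of [m] over the vertices all of
    whose copies lie in [Y]. The resulting function is 0-1 valued, hence the indicator of a set
    [I]. *)
Lemma independent_multiplicities (m : V -> nat) :
  (forall X : {set V}, \sum_(v in X) m v <= rank M (copies at_ X))%N ->
  exists2 I : {set S}, independent M I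
    & forall v, m v = #|I :&: copies at_ [set v]|.
Proof.
move=> mr; pose full (Y : {set S}) := [set v | copies at_ [set v] \subset Y].
pose p (Y : {set S}) : int := \sum_(v in full Y) (m v)%:Z.
have p_le Y : p Y <= (rank M Y)%:Z.
  rewrite /p -Posz_sum lez_nat; apply: leq_trans (mr _) (rank_mono M _).
  apply/subsetP => s; rewrite !inE => /subsetP; apply.
  by rewrite !inE.
have p_ge (Y : {set S}) (X : {set V}) : X \subset full Y -> \sum_(v in X) (m v)%:Z <= p Y.
  move=> XY; rewrite /p [leRHS](big_setID X) /= (setIidPr XY) lerDl.
  by apply: sumr_ge0.
have sp : supermodular p.
  move=> X Y; rewrite /p -sumID; apply: lerD; apply: p_ge.
    by apply/subsetP => v; rewrite !inE subsetI.
  apply/subUsetP; split; apply/subsetP => v; rewrite !inE => /subset_trans -> //.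
    exact: subsetUl.
  exact: subsetUr.
(* A vertex without copies belongs to [full set0], but the rank bound makes its [m] vanish. *)
have p0 : p set0 = 0.
  apply/eqP; rewrite eq_le; have := p_le set0; rewrite rank0 => -> /=.
  exact: sumr_ge0.
(* Lowering the upper bound on [setT] to [p setT] fixes the total of [x] as the total of [m]; this
   turns the inequalities [m_le] into equalities. *)
have [||||x xP] := @sandwich _ p (fun Y => if Y == setT then - p setT else - (rank M Y)%:Z) sp.
- by apply: (supermodular_raiseT rank_supermodularN); rewrite lerN2.
- by move=> Y /=; case: eqP => [->|_]; [rewrite subrr | rewrite subr_le0].
- exact: p0.
- by case: eqP => [<-|_]; rewrite ?p0 ?rank0 oppr0.
have x_le (Y : {set S}) : \sum_(s in Y) x s <= (rank M Y)%:Z.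
  have [_] := xP Y; case: eqP => [->|_]; rewrite lerN2 // => xT.
  exact: le_trans xT (p_le _).
have x01 s : 0 <= x s <= 1.
  have [+ _] := xP [set s]; have := x_le [set s]; rewrite !big_set1.
  have := rank_subcard M [set s]; rewrite cards1.
  have : 0 <= p [set s] by apply: sumr_ge0.
  by lia.
pose I := [set s | x s == 1].
have xI (Y : {set S}) : \sum_(s in Y) x s = #|I :&: Y|.
  rewrite -sum1_card Posz_sum big_mkcond [RHS]big_mkcond; apply: eq_bigr => s _.
  rewrite !inE; have := x01 s; case: (s \in Y); rewrite ?andbF // andbT.
  by case: eqP => //; lia.
have m_le v : (m v <= #|I :&: copies at_ [set v]|)%N.
  rewrite -lez_nat -xI; apply: le_trans (xP _).1.
  have := p_ge (copies at_ [set v]) [set v].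
  by rewrite sub1set inE big_set1; apply.
have m_ge : (\sum_v #|I :&: copies at_ [set v]| <= \sum_v m v)%N.
  have := card_copies I setT; rewrite (eq_bigl predT) => [->|v]; last by rewrite inE.
  have -> : copies at_ setT = setT by apply/setP => s; rewrite !inE.
  rewrite -lez_nat -xI; have [_] := xP setT; rewrite eqxx lerN2 => /le_trans; apply.
  rewrite Posz_sum /p big_mkcond; apply: ler_sum => v _.
  by case: ifP.
exists I; first by rewrite /independent eqn_leq rank_subcard /= -lez_nat -{1}(setIid I) -xI.
have := leqif_sum (fun v (_ : predT v) => leqif_eq (m_le v)).
move=> [le1 eq1]; move: eq1; rewrite eqn_leq le1 m_ge /= => /esym/forallP eqm v.
by apply/eqP; apply: eqm.
Qed.
End Rado.

Lemma disjoint_setU (T : finType) (A B C : {set T}) :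
  [disjoint A :|: B & C] = [disjoint A & C] && [disjoint B & C].
Proof. by rewrite -!setI_eq0 setIUl setU_eq0. Qed.

(** * Edmonds' theorem on disjoint arborescences with prescribed root multiplicities *)

Section Arborescences.
Local Open Scope nat_scope.
Variables (V : finType) (D : digraph V).
Implicit Types (X Y U R : {set V}) (A B : {set Defs.arc D}).
Implicit Types (a : Defs.arc D) (p : seq (Defs.arc D)).

Lemma dipath_rcons u p a v :
  dipath u (rcons p a) v = dipath u p (arc_tail a) && (arc_head a == v).
Proof.
elim: p u => [|b p IHp] u /=; first by rewrite eq_sym.
by rewrite IHp andbA.
Qed.

Lemma is_arborescence1 r : is_arborescence r [set r] (set0 : {set Defs.arc D}).
Proof.
split=> [|a|v]; rewrite ?inE // => /eqP->; exists [::]; split=> [|[|a p]] //=.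
by rewrite inE.
Qed.

(** Read backwards from its end in [U], the path never leaves [U], so it cannot use [a], whose head
    is outside. *)
Lemma dipath_within U B a s p v :
  (forall b, b \in B -> (arc_tail b \in U) && (arc_head b \in U)) ->
  arc_head a \notin U -> v \in U ->
  all (mem (a |: B)) p -> dipath s p v -> all (mem B) p.
Proof.
move=> BU aU; elim/last_ind: p v => // p b IHp v vU.
rewrite !all_rcons dipath_rcons !inE => /andP[bB pB] /andP[sp /eqP bv].
have {}bB : b \in B by case/predU1P: bB => // ba; rewrite -ba bv vU in aU.
have /andP[tU _] := BU b bB.
by rewrite bB (IHp _ tU).
Qed.

Lemma is_arborescenceU1 s U B a : is_arborescence s U B ->
  arc_tail a \in U -> arc_head a \notin U ->
  is_arborescence s (arc_head a |: U) (a |: B).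
Proof.
move=> [sU BU path] tU hU; split.
- by rewrite inE sU orbT.
- move=> b; rewrite !inE => /predU1P[->|/BU/andP[-> ->]]; last by rewrite !orbT.
  by rewrite tU eqxx orbT.
have sub q : all (mem B) q -> all (mem (a |: B)) q.
  by apply: sub_all => b /= bB; rewrite inE bB orbT.
move=> v /setU1P[->|vU].
  have [q [/andP[qB sq] qU]] := path _ tU.
  exists (rcons q a); split.
    by rewrite all_rcons dipath_rcons !inE !eqxx sq sub.
  move=> q'; case/lastP: q' => [|q' b] /=; first by move=> /eqP sa; rewrite -sa sU in hU.
  rewrite all_rcons dipath_rcons !inE => /andP[/andP[bB q'B] /andP[sq' /eqP ba]].
  have {}bB : b = a by case/predU1P: bB => // /BU/andP[_]; rewrite ba (negPf hU).
  rewrite bB in ba sq' *; congr rcons; apply: qU; rewrite sq' andbT.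
  exact: (dipath_within BU hU tU q'B sq').
have [q [/andP[qB sq] qU]] := path _ vU.
exists q; split; first by rewrite sq sub.
move=> q' /andP[q'B sq']; apply: qU; rewrite sq' andbT.
exact: (dipath_within BU hU vU q'B sq').
Qed.

(* c sends each vertex of U to the root of its component. *)
Definition branching R U B (c : V -> V) : Prop :=
  [/\ forall a, a \in B -> arc_head a \in U,
      forall v, v \in U -> c v \in R
    & forall r, r \in R -> is_arborescence r [set v in U | c v == r]
                             [set a in B | c (arc_head a) == r]].

Lemma branching_sub R U B c : branching R U B c -> R \subset U.
Proof.
by move=> [_ _ arb]; apply/subsetP => r /arb[]; rewrite inE => /andP[].
Qed.

Lemma branching_root R U B c v : branching R U B c -> v \notin U ->
  branching (v |: R) (v |: U) B (fun x => if x == v then v else c x).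
Proof.
move=> br vU; have RU := subsetP (branching_sub br); have [BU cR arb] := br.
have vR : v \notin R by apply: contraNN vU => /RU.
split.
- by move=> a /BU aU; rewrite inE aU orbT.
- move=> x; rewrite !inE; case: eqP => [_ _|_ /cR ->]; by rewrite ?eqxx ?orbT.
have cv x : x \in U -> (x == v) = false by move=> xU; apply: contraNF vU => /eqP <-.
move=> r /setU1P[->|rR].
  have -> : [set x in v |: U | (if x == v then v else c x) == v] = [set v].
    apply/setP => x; rewrite !inE; case: eqP => [->|_] /=; first by rewrite eqxx.
    by apply/negP => /andP[/cR cxR /eqP cx]; rewrite cx (negPf vR) in cxR.
  rewrite (_ : [set a in B | _] = set0); first exact: is_arborescence1.
  apply/setP => a; rewrite !inE; apply/negP => /andP[/BU aU]; rewrite (cv _ aU) => /eqP ca.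
  by have := cR _ aU; rewrite ca (negPf vR).
have := arb r rR; congr is_arborescence; apply/setP => x; rewrite !inE.
  case: (x =P v) => [->|_] //=; rewrite (negPf vU) /=; apply/esym/eqP => vr.
  by rewrite vr rR in vR.
by case: (boolP (x \in B)) => //= /BU xU; rewrite (cv _ xU).
Qed.

Lemma branching_arc R U B c a : branching R U B c ->
  arc_tail a \in U -> arc_head a \notin U ->
  branching R (arc_head a |: U) (a |: B)
    (fun x => if x == arc_head a then c (arc_tail a) else c x).
Proof.
move=> [BU cR arb] tU hU.
have ch x : x \in U -> (x == arc_head a) = false.
  by move=> xU; apply: contraNF hU => /eqP <-.
split.
- by move=> b; rewrite !inE => /predU1P[->|/BU->]; rewrite ?eqxx ?orbT.
- by move=> x /setU1P[->|xU]; rewrite ?eqxx ?cR // ch // cR.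
move=> r rR.
have aB : a \notin B by apply: contraNN hU => /BU.
have cB b : b \in B -> (if arc_head b == arc_head a then c (arc_tail a)
    else c (arc_head b)) = c (arc_head b) by move=> /BU bU; rewrite ch.
have [<-|car] := eqVneq (c (arc_tail a)) r.
  have := is_arborescenceU1 (arb (c (arc_tail a)) (cR _ tU)) (a := a).
  rewrite !inE tU eqxx (negPf hU) => /(_ isT isT).
  congr is_arborescence; apply/setP => x; rewrite !inE.
    by case: (x =P arc_head a) => //= _; rewrite eqxx.
  case: (x =P a) => [->|_] /=; first by rewrite !eqxx.
  by case: (boolP (x \in B)) => //= /cB ->.
have := arb r rR; congr is_arborescence; apply/setP => x; rewrite !inE.
  by case: (x =P arc_head a) => [->|_] //=; rewrite (negPf hU) (negPf car).
case: (x =P a) => [->|_] /=; first by rewrite eqxx (negPf car) (negPf aB).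
by case: (boolP (x \in B)) => //= /cB ->.
Qed.

(** The in-degree of [X] once a new source is joined to each [v] by [m v] parallel arcs; roots thus
    count as arcs. *)
Definition supply A (m : V -> nat) X : nat :=
  \sum_(a in A) ((arc_head a \in X) && (arc_tail a \notin X)) + \sum_(v in X) m v.

Lemma supply_submodular A m X Y :
  supply A m (X :&: Y) + supply A m (X :|: Y) <= supply A m X + supply A m Y.
Proof.
rewrite /supply addnACA [leqRHS]addnACA -!big_split leq_add //=.
  apply: leq_sum => a _; rewrite !inE.
  by case: (arc_head a \in X); case: (arc_head a \in Y);
     case: (arc_tail a \in X); case: (arc_tail a \in Y).
rewrite ![\sum_(v in _) _]big_mkcond -!big_split /=; apply: leq_sum => v _.
by rewrite !inE; case: (v \in X); case: (v \in Y); rewrite /= ?addn0 ?add0n.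
Qed.

Lemma supplyD1 A m a X : a \in A -> supply A m X =
  ((arc_head a \in X) && (arc_tail a \notin X)) + supply (A :\ a) m X.
Proof. by move=> aA; rewrite /supply (big_setD1 a aA) addnA. Qed.

Lemma supply_root A (m : V -> nat) v X : 0 < m v ->
  supply A m X = (v \in X) + supply A (fun x => m x - (x == v)) X.
Proof.
move=> mv; rewrite /supply addnCA; congr (_ + _).
case: (boolP (v \in X)) => vX.
  rewrite !(big_setD1 v vX) /= eqxx addnA subnKC //; congr (_ + _).
  by apply: eq_bigr => x; rewrite !inE => /andP[/negPf->]; rewrite subn0.
by apply: eq_bigr => x xX; case: eqP => [xv|_]; [rewrite -xv xX in vX | rewrite subn0].
Qed.

(* Lovasz's step: the arc is taken inside a minimal tight set not contained in U,
   and any arc or root will do if there is none. *)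
Lemma branching_step A (m : V -> nat) k U : U != setT ->
  (forall X, X != set0 -> k <= supply A m X) ->
  (forall X, X != set0 -> [disjoint X & U] -> k < supply A m X) ->
  (exists a, [/\ a \in A, arc_tail a \in U, arc_head a \notin U
     & forall X, X != set0 -> k <= supply (A :\ a) m X]) \/
  (exists v, [/\ v \notin U, 0 < m v
     & forall X, X != set0 -> k <= supply A (fun x => m x - (x == v)) X]).
Proof.
move=> UT le_k lt_k.
have sub0 X : ~~ (X \subset U) -> X != set0 by apply: contraNneq => ->; rewrite sub0set.
have [X0 X0P|none] := pickP [pred X : {set V} | ~~ (X \subset U) & supply A m X <= k].
  have [X /andP[XU Xk] Xmin] := arg_minnP (fun X : {set V} => #|X|) X0P.
  have ltXU : supply A m X < supply A m (X :\: U).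
    apply: leq_ltn_trans Xk (lt_k _ _ _); first by rewrite setD_eq0.
    by rewrite -setI_eq0 setIDAC -setIDA setDv setI0.
  (* [X :\: U] has larger supply than [X] but no more roots, so some arc enters it without entering
     [X]; its tail lies in [X :&: U]. *)
  have [a aA /and3P[]] : exists2 a, a \in A &
      [&& arc_head a \in X, arc_head a \notin U & (arc_tail a \in X) && (arc_tail a \in U)].
    apply/exists_inP; rewrite -[X in is_true X]negbK negb_exists_in.
    apply/negP => /forall_inP none; move: ltXU; rewrite ltnNge => /negP; apply.
    apply: leq_add.
      apply: leq_sum => a /none; rewrite !inE.
      by case: (arc_head a \in X); case: (arc_head a \in U);
        case: (arc_tail a \in X); case: (arc_tail a \in U).
    by rewrite [leqRHS](big_setID (~: U)) -setDE leq_addr.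
  move=> hX hU /andP[tX tU]; left; exists a; split=> // Y Y0.
  have [//|ltY] := leqP k (supply (A :\ a) m Y).
  have leY := le_k Y Y0; have := supplyD1 m Y aA.
  have [/andP[hY tY] Yk|_ Yk] := boolP (_ && _); last by rewrite Yk add0n leqNgt ltY in leY.
  (* If losing [a] violates the bound on [Y], then [Y] is tight and entered by [a]. Uncrossing makes
     [X :&: Y] tight; minimality gives [X :&: Y = X], although the tail of [a] is in [X] and not in
     [Y]. *)
  have XYk : supply A m (X :&: Y) <= k.
    have := supply_submodular A m X Y; have := le_k (X :|: Y).
    have -> : X :|: Y != set0 by rewrite setU_eq0 negb_and Y0 orbT.
    by move=> /(_ isT); lia.
  have := Xmin (X :&: Y); rewrite /= XYk andbT => /(_ _)/wrap[].
    by apply/subsetPn; exists (arc_head a); rewrite ?inE ?hX.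
  move=> XY; have /eqP XE : X :&: Y == X by rewrite eqEcard subsetIl.
  by move: tX; rewrite -XE inE (negPf tY) andbF.
have ltX X : ~~ (X \subset U) -> k < supply A m X.
  by move=> XU; have := none X; rewrite /= XU ltnNge => /negbT.
have [|] := boolP [exists a in A, (arc_tail a \in U) && (arc_head a \notin U)].
  move=> /exists_inP[a aA /andP[tU hU]]; left; exists a; split=> // X X0.
  have := supplyD1 m X aA; have [/andP[hX _]|_] := boolP (_ && _).
  2: by rewrite add0n => <-; apply: le_k.
  have /ltX : ~~ (X \subset U) by apply/subsetPn; exists (arc_head a).
  by move=> + E; rewrite E.
rewrite negb_exists_in => /forall_inP noarc; right.
(* No arc leaves [U], so this supply consists of roots, and one of them lies outside [U]. *)
have : k < supply A m (~: U).
  apply: ltX; apply: contra UT => UU; rewrite -subTset -(setUCr U) subUset subxx.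
  exact: UU.
rewrite /supply big1 => [|a /noarc]; last first.
  by rewrite !inE negbK; case: (arc_tail a \in U); case: (arc_head a \in U).
rewrite add0n => /(leq_ltn_trans (leq0n k)).
rewrite lt0n sum_nat_eq0 negb_forall => /existsP[v]; rewrite negb_imply -lt0n inE => /andP[vU mv].
exists v; split=> // X X0; have := supply_root A X mv.
case: (boolP (v \in X)) => [vX|_] E; last by move: (le_k X X0); rewrite E add0n.
have /ltX : ~~ (X \subset U) by apply/subsetPn; exists v.
by rewrite E.
Qed.

(** The current branching has yet to reach every set disjoint from [U], whence the strict bound
    there. It survives a step: a set avoiding the newly reached vertex loses neither an arc nor a
    root. *)
Lemma branching_complete k A (m : V -> nat) R U B c :
  branching R U B c -> [disjoint B & A] ->
  (forall X, X != set0 -> k <= supply A m X) ->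
  (forall X, X != set0 -> [disjoint X & U] -> k < supply A m X) ->
  exists R' B' c' A' m',
    [/\ branching R' setT B' c', [/\ B' \subset B :|: A, A' \subset A & [disjoint B' & A']],
      forall X, X != set0 -> k <= supply A' m' X
    & forall v, m' v <= m v /\ m' v + (v \in R') = m v + (v \in R)].
Proof.
elim: {U}_.+1 {-2}U (ltnSn #|~: U|) A m R B c => // n IHn U ltUn A m R B c br BA le_k lt_k.
have [UT|UT] := eqVneq U setT.
  rewrite UT in br; exists R, B, c, A, m; split=> //.
  by rewrite subsetUl.
have cardU v : v \notin U -> #|~: (v |: U)| < n.
  by move=> vU; move: ltUn; rewrite (cardsD1 v) inE vU setCU setIC -setDE.
have disjU X v : [disjoint X & v |: U] -> [disjoint X & U] /\ v \notin X.
  by rewrite disjoint_sym disjoint_setU disjoints1 disjoint_sym => /andP[].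
have [[a [aA tU hU le_k']]|[v [vU mv le_k']]] := branching_step UT le_k lt_k.
  have [||R' [B' [c' [A' [m' [br' [B'A A'A B'A'] le_kA' mm']]]]]] :=
    IHn _ (cardU _ hU) (A :\ a) m _ _ _ (branching_arc br tU hU) _ le_k' _.
  - rewrite disjoint_setU disjoints1 !inE eqxx /=.
    by apply: disjointWr BA; rewrite subD1set.
  - move=> X X0 /disjU[ltX /negPf hX]; have := lt_k X X0 ltX.
    by rewrite (supplyD1 _ _ aA) hX add0n.
  exists R', B', c', A', m'; split=> //; split=> //.
    by rewrite -(setD1K aA) setUCA setUA.
  by apply: subset_trans A'A _; rewrite subD1set.
have [|R' [B' [c' [A' [m' [br' B'A le_kA' mm']]]]]] :=
  IHn _ (cardU _ vU) A (fun x => m x - (x == v)) _ _ _ (branching_root br vU) BA le_k' _.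
- move=> X X0 /disjU[ltX /negPf hX]; have := lt_k X X0 ltX.
  by rewrite (supply_root _ _ mv) hX add0n.
exists R', B', c', A', m'; split=> // x; have [le1 eq1] := mm' x; split.
  by apply: leq_trans le1 (leq_subr _ _).
rewrite eq1 inE in_set1; have [->|//] := eqVneq x v; last by rewrite subn0.
have /negPf-> : v \notin R by apply: contraNN vU => /(subsetP (branching_sub br)).
by rewrite addn0 subnK.
Qed.

Lemma arborescence_seq (s : seq V) (U : V -> {set V}) (B : V -> {set Defs.arc D}) :
  (forall r, r \in s -> is_arborescence r (U r) (B r)) ->
  exists P : seq (arborescence D), [/\ map (@root_of _ _) P = s,
    map (@verts_of _ _) P = map U s & map (@arcs_of _ _) P = map B s].
Proof.
elim: s => [|r s IHs] arb; first by exists [::].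
have [|P [rP vP aP]] := IHs; first by move=> x xs; apply: arb; rewrite inE xs orbT.
exists (Arborescence (arb r (mem_head r s)) :: P).
by rewrite /= rP vP aP.
Qed.

(** The components of a spanning branching partition the vertices, and an arc belongs to the
    component of its head. *)
Lemma branching_packing R B c : branching R setT B c ->
  exists P : seq (arborescence D), [/\ packing P,
    all (fun T : arborescence D => arcs_of T \subset B) P,
    forall v, rooted_at P v = (v \in R)
    & forall v, count (fun T : arborescence D => v \in verts_of T) P = 1].
Proof.
move=> [BU cR arb].
have [r|P [rP vP aP]] := @arborescence_seq (enum R)
    (fun r => [set v in setT | c v == r]) (fun r => [set a in B | c (arc_head a) == r]).
  by rewrite mem_enum => /arb.
exists P; split.
- suff : pairwise (fun A B : {set Defs.arc D} => [disjoint A & B]) (map (@arcs_of _ _) P).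
    by rewrite pairwise_map.
  rewrite aP pairwise_map.
  have := enum_uniq R; rewrite uniq_pairwise; apply: sub_pairwise => r r' /= rr'.
  rewrite -setI_eq0; apply/eqP/setP => a; rewrite !inE.
  case: eqP => [->|]; last by rewrite andbF.
  by rewrite (negPf rr') !andbF.
- have : all (fun A : {set Defs.arc D} => A \subset B) (map (@arcs_of _ _) P).
    by rewrite aP; apply/allP => A /mapP[r _ ->]; apply/subsetP => a; rewrite inE => /andP[].
  by rewrite all_map.
- move=> v; rewrite /rooted_at -(count_map (@root_of _ _) (pred1 v)) rP.
  by rewrite count_uniq_mem ?enum_uniq // mem_enum.
- move=> v; rewrite -(count_map (@verts_of _ _) (fun U : {set V} => v \in U)) vP.
  rewrite count_map (eq_count (a2 := pred1 (c v))) => [|r /=]; last by rewrite !inE eq_sym.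
  by rewrite count_uniq_mem ?enum_uniq // mem_enum cR ?inE.
Qed.

(* Starting each branching from the vertices at which all remaining k + 1
   branchings must still be rooted keeps m <= k. *)
Lemma arborescence_packing k A (m : V -> nat) :
  (forall v, m v <= k) -> (forall X, X != set0 -> k <= supply A m X) ->
  exists P : seq (arborescence D), [/\ packing P,
    all (fun T : arborescence D => arcs_of T \subset A) P,
    forall v, rooted_at P v = m v & regular k P].
Proof.
elim: k A m => [|k IHk] A m mk le_k.
  exists [::]; split=> // v.
  by apply/esym/eqP; rewrite -leqn0.
pose R := [set v | m v == k.+1].
pose m0 v := m v - (v \in R).
have m0R v : m0 v + (v \in R) = m v.
  by rewrite subnK // inE; case: eqP => // ->.
have m0k v : m0 v <= k.
  by have := mk v; rewrite /m0 inE; case: eqP => [->|]; lia.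
have br : branching R R set0 id.
  split=> [a|//|r rR]; first by rewrite inE.
  have := is_arborescence1 r; congr is_arborescence; apply/setP => x; rewrite !inE.
    by case: eqP => [->|]; rewrite ?andbF // -[_ == _](in_set (fun v => m v == k.+1)) rR.
  by [].
have lt_k X : X != set0 -> [disjoint X & R] -> k < supply A m0 X.
  move=> X0 /pred0P XR; apply: leq_trans (le_k X X0) _.
  rewrite leq_add2l; apply: leq_sum => v vX; rewrite -m0R.
  by have := XR v; rewrite /= vX /= => ->; rewrite addn0.
have [||R' [B [c [A' [m' [br' [BA AA' BA'] le_k' mm']]]]]] :=
  branching_complete (k := k) br (_ : [disjoint set0 & A]) _ lt_k.
- by rewrite -setI_eq0 set0I.
(* A set meeting [R] contains a vertex that still has [k] roots after giving one up. *)
- move=> X X0; have [|/pred0Pn[v /= /andP[vX vR]]] := boolP [disjoint X & R].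
    by move=> /(lt_k X X0)/ltnW.
  apply: leq_trans (leq_addl _ _); rewrite (big_setD1 v vX) /=.
  apply: leq_trans (leq_addr _ _); rewrite /m0 vR.
  by move: vR; rewrite inE => /eqP->; rewrite subn1.
have m'k v : m' v <= k by have [le1 _] := mm' v; apply: leq_trans le1 _.
have [P2 [pP2 aP2 rP2 vP2]] := IHk A' m' m'k le_k'.
have [P1 [pP1 aP1 rP1 vP1]] := branching_packing br'.
exists (P1 ++ P2); split.
- rewrite /packing pairwise_cat; apply/and3P; split=> //.
  apply: sub_all aP1 => T1 /= T1B; apply: sub_all aP2 => T2 /= T2A'.
  exact: disjointW BA'.
- rewrite all_cat; apply/andP; split.
    rewrite set0U in BA; apply: sub_all aP1 => T /= TB.
    exact: subset_trans TB BA.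
  apply: sub_all aP2 => T /= TA'.
  exact: subset_trans TA' AA'.
- move=> v; rewrite /rooted_at count_cat -!/(rooted_at _ v) rP1 rP2 addnC.
  by have [_ ->] := mm' v; rewrite m0R.
- by move=> v; rewrite count_cat vP1 vP2 add1n.
Qed.
End Arborescences.

(** At most one member of a disjoint family contains [x], so at most one term of the sum is 1. *)
Lemma leq_sum_trivIset (T : finType) (P : {set {set T}}) (b : pred {set T}) x :
  trivIset P -> (forall X, X \in P -> b X -> x \in X) ->
  (\sum_(X in P) b X <= [exists X in P, b X])%N.
Proof.
move=> tP bx; have [/exists_inP[X XP bX]|] := boolP [exists X in P, b X].
  rewrite (big_setD1 X XP) bX /= big1 // => Y; rewrite !inE => /andP[YX YP].
  apply/eqP; rewrite eqb0; apply/negP => bY.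
  have /pred0P/(_ x) := trivIsetP tP _ _ YP XP YX.
  by rewrite /= bx // bx.
by rewrite negb_exists_in => /forall_inP nb; rewrite big1 // => X /nb /negPf->.
Qed.

(** * Counting roots and entering arcs in a given packing *)

Section Counting.
Local Open Scope nat_scope.
Variables (V : finType) (D : digraph V).
Implicit Types (X : {set V}) (T : arborescence D) (P : seq (arborescence D)).

Definition arcs_into X : {set Defs.arc D} :=
  [set a | (arc_head a \in X) && (arc_tail a \notin X)].

Lemma dipath_into X s p v (B : {set Defs.arc D}) : v \in X ->
  all (mem B) p -> dipath s p v -> (s \in X) || (B :&: arcs_into X != set0).
Proof.
elim/last_ind: p v => [|p a IHp] v vX /=; first by move=> _ /eqP->; rewrite vX.
rewrite all_rcons dipath_rcons => /andP[aB pB] /andP[sp /eqP av].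
have [tX|tX] := boolP (arc_tail a \in X); first exact: IHp tX pB sp.
by apply/orP; right; apply/set0Pn; exists a; rewrite !inE av vX tX !andbT.
Qed.

Lemma arborescence_into X T v : v \in X -> v \in verts_of T ->
  1 <= (root_of T \in X) + #|arcs_of T :&: arcs_into X|.
Proof.
move=> vX vT; have [_ _ /(_ v vT)[p [/andP[pB sp] _]]] := arborescenceP T.
have := dipath_into vX pB sp; rewrite -card_gt0.
by case: (_ \in X); case: #|_|.
Qed.

Lemma sum_rooted_at P X : \sum_(v in X) rooted_at P v = \sum_(T <- P) (root_of T \in X).
Proof.
elim: P => [|T P IHP]; first by rewrite big_nil big1.
rewrite big_cons -IHP /rooted_at /= big_split /=; congr (_ + _).
rewrite big_mkcond (bigD1 (root_of T)) //= eqxx big1 => [|v]; first by case: ifP.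
by rewrite eq_sym => /negPf->; case: ifP.
Qed.

Lemma sum_card_disjoint (I : finType) (s : seq {set I}) (E : {set I}) :
  pairwise (fun A B : {set I} => [disjoint A & B]) s -> \sum_(A <- s) #|A :&: E| <= #|E|.
Proof.
elim: s E => [|A s IHs] E /=; first by rewrite big_nil.
move=> /andP[/allP As /IHs{}IHs]; rewrite big_cons -(cardsID A E) setIC leq_add2l.
apply: leq_trans (IHs (E :\: A)); rewrite !big_seq; apply: leq_sum => B /As AB.
rewrite setIDA (setDidPl _) // disjoint_sym; apply: disjointWr AB; exact: subsetIl.
Qed.

(** Each of the [h] arborescences through a fixed vertex of [X] has its root in [X] or an arc
    entering [X], and these arcs are distinct. *)
Lemma packing_supply h P X : packing P -> regular h P -> X != set0 ->
  h <= \sum_(v in X) rooted_at P v + #|arcs_into X|.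
Proof.
move=> pP hP /set0Pn[v vX]; rewrite -(hP v) sum_rooted_at.
apply: leq_trans (_ : \sum_(T <- P) ((root_of T \in X) + #|arcs_of T :&: arcs_into X|) <= _).
  rewrite -sum1_count big_mkcond; apply: leq_sum => T _.
  by case: ifP => // vT; apply: arborescence_into vX vT.
rewrite big_split /= leq_add2l -(big_map (@arcs_of _ _) predT (fun A => #|A :&: arcs_into X|)).
by apply: sum_card_disjoint; rewrite pairwise_map.
Qed.

Lemma rooted_at_regular h P v : regular h P -> rooted_at P v <= h.
Proof.
move=> hP; rewrite -(hP v); apply: sub_count => T /= /eqP <-.
by have [] := arborescenceP T.
Qed.

Lemma size_rooted_at P : size P = \sum_v rooted_at P v.
Proof.
have := sum_rooted_at P setT; rewrite (eq_bigl predT) => [->|v]; last by rewrite inE.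
by rewrite -sum1_size; apply: eq_bigr => T _; rewrite inE.
Qed.

End Counting.

(** * Entering hyperedges and dyperedges, before and after orientation and trimming *)

Section Hypergraphs.
Local Open Scope nat_scope.
Variables (V : finType) (F : mixed_hypergraph V).
Implicit Types (X : {set V}) (P : {set {set V}}).

Lemma setIC_neq0 (A X : {set V}) : (A :&: ~: X != set0) = ~~ (A \subset X).
Proof. by rewrite setI_eq0 disjoints_subset setCK. Qed.

Lemma enteringE P : entering F P =
  \sum_(e : hyperedge F) [exists X in P, hy_enters e X]
  + \sum_(a : dyperedge F) [exists X in P, dy_enters a X].
Proof.
rewrite /entering -!sum1_card; congr (_ + _).
  by rewrite big_mkcond; apply: eq_bigr => e _; rewrite inE; case: ifP.
by rewrite big_mkcond; apply: eq_bigr => a _; rewrite inE; case: ifP.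
Qed.

(** A hyperedge contained in one block is disjoint from the others and enters none, so it is counted
    at most once on the left, and only if it meets the cover. *)
Lemma entering_le P : trivIset P ->
  entering F P + \sum_(X in P) \sum_(e : hyperedge F) (hy_set e \subset X) <=
  \sum_(e : hyperedge F) meets (hy_set e) (cover P)
  + \sum_(X in P) \sum_(a : dyperedge F) enters (dy_tails a) (dy_head a) X.
Proof.
move=> tP; rewrite enteringE addnAC leq_add //.
  rewrite exchange_big -big_split /=; apply: leq_sum => e _.
  have [x xe] : exists x, x \in hy_set e.
    by apply/set0Pn; rewrite -card_gt0; apply: ltnW (hy_card e).
  apply: leq_trans (leq_add (leqnn _)
    (leq_sum_trivIset (x := x) (b := fun X : {set V} => hy_set e \subset X) tP _)) _.
    by move=> X _ /subsetP; apply.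
  have in_cover X : X \in P -> X \subset cover P by move=> XP; apply: bigcup_sup XP.
  have [/exists_inP[X XP eX]|_] := boolP [exists X in P, hy_set e \subset X].
    have /negPf-> : ~~ [exists Y in P, hy_enters e Y].
      rewrite negb_exists_in; apply/forall_inP => Y YP.
      rewrite /hy_enters setIC_neq0 negb_and negbK orbC -implyNb negbK.
      apply/implyP => neY.
      have XY : X != Y by apply: contraNneq neY => <-.
      have /pred0P dXY := trivIsetP tP _ _ XP YP XY.
      apply/eqP/setP => y; rewrite !inE; apply/negP => /andP[ye yY].
      by have := dXY y; rewrite /= yY (subsetP eX).
    rewrite (_ : meets _ _ = true) //; apply/set0Pn; exists x.
    by rewrite inE xe (subsetP (in_cover X XP)) // (subsetP eX).
  rewrite addn0; have [/exists_inP[X XP]|//] := boolP [exists X in P, hy_enters e X].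
  move=> /andP[/set0Pn[y]]; rewrite inE => /andP[ye yX] _.
  rewrite (_ : meets _ _ = true) //; apply/set0Pn; exists y.
  by rewrite inE ye (subsetP (in_cover X XP)).
rewrite exchange_big; apply: leq_sum => a _ /=.
have [/exists_inP[X XP]|//] := boolP [exists X in P, dy_enters a X].
rewrite /dy_enters setIC_neq0 -/(enters _ _ _) => aX.
by rewrite (big_setD1 X XP) aX.
Qed.

(** An arc enters at most the one block containing its head, and the hyperedge or dyperedge it comes
    from enters that block too. *)
Lemma sum_arcs_into_le (o : hyperedge F -> V) (oP : forall e, o e \in hy_set e)
    (t : dyperedge (orient oP) -> V) (tP : forall a, t a \in dy_tails a) P :
  trivIset P -> \sum_(X in P) #|@arcs_into _ (trim tP) X| <= entering F P.
Proof.
move=> trP; rewrite enteringE.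
under eq_bigr => X _ do rewrite -sum1_card big_mkcond big_sumType /=.
rewrite big_split /=; apply: leq_add; rewrite exchange_big; apply: leq_sum => e _ /=.
  apply: leq_trans (leq_sum_trivIset (x := o e)
    (b := fun X => inl e \in @arcs_into _ (trim tP) X) trP _) _.
    by move=> X _; rewrite inE => /andP[].
  have [/exists_inP[X XP]|//] := boolP [exists X in P, inl e \in @arcs_into _ (trim tP) X].
  have := tP (inl e); rewrite !inE /= => /andP[_ te] /andP[oX tX].
  rewrite (_ : [exists Y in P, hy_enters e Y] = true) //; apply/exists_inP; exists X => //.
  rewrite /hy_enters setIC_neq0; apply/andP; split.
    by apply/set0Pn; exists (o e); rewrite inE oP.
  by apply/subsetPn; exists (t (inl e)).
apply: leq_trans (leq_sum_trivIset (x := dy_head e)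
  (b := fun X => inr e \in @arcs_into _ (trim tP) X) trP _) _.
  by move=> X _; rewrite inE => /andP[].
have [/exists_inP[X XP]|//] := boolP [exists X in P, inr e \in @arcs_into _ (trim tP) X].
have := tP (inr e); rewrite !inE /= => te /andP[oX tX].
rewrite (_ : [exists Y in P, dy_enters e Y] = true) //; apply/exists_inP; exists X => //.
by rewrite /dy_enters setIC_neq0 oX /=; apply/subsetPn; exists (t (inr e)).
Qed.

(** A hyperedge with its head in [X] lies inside [X] or enters [X] once oriented. *)
Lemma orient_arcs_into (o : hyperedge F -> V) (oP : forall e, o e \in hy_set e) X :
  \sum_(e : hyperedge F) (o e \in X) + \sum_(a : dyperedge F) enters (dy_tails a) (dy_head a) X
  <= \sum_(e : hyperedge F) (hy_set e \subset X)
     + \sum_(a : dyperedge (orient oP)) enters (dy_tails a) (dy_head a) X.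
Proof.
rewrite [X in _ <= _ + X]big_sumType /= addnA leq_add2r -big_split /=.
apply: leq_sum => e _; rewrite /enters.
have [oX|//] := boolP (o e \in X); have [//|eX] := boolP (hy_set e \subset X).
have -> // : ~~ (hy_set e :\ o e \subset X).
by apply: contra eX => eX; rewrite -(setD1K (oP e)) subUset sub1set oX.
Qed.

End Hypergraphs.

Lemma sum_setDU (V : finType) (m : V -> nat) (X Z : {set V}) :
  (weight m X + weight m (Z :\: X) = weight m Z + weight m (X :\: Z))%N.
Proof.
rewrite /weight ![(\sum_(v in _) _)%N]big_mkcond -!big_split /=.
by apply: eq_bigr => v _; rewrite !inE; case: (v \in X); case: (v \in Z); rewrite /= ?addn0.
Qed.

Lemma leq_weight (V : finType) (m n : V -> nat) (X : {set V}) :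
  (forall v, m v <= n v)%N -> (weight m X <= weight n X)%N.
Proof. by move=> mn; apply: leq_sum. Qed.

Lemma weightC (V : finType) (m : V -> nat) (X : {set V}) :
  (weight m X + weight m (~: X) = \sum_v m v)%N.
Proof.
have := sum_setDU m X setT; rewrite setTD => ->.
by rewrite setDT /weight big_set0 addn0; apply: eq_bigl => v; rewrite inE.
Qed.

(** * Necessity and sufficiency of the four conditions *)

Section Conditions.
Variables (V : finType) (F : mixed_hypergraph V) (f g : V -> nat) (h alpha beta : nat).
Variables (S : finType) (at_ : S -> V) (M : matroid S).

Definition packing_conditions : Prop :=
  [/\ (forall v : V, (f v <= truncate g h v)%N),
      (alpha <= beta)%N,
      (forall X Z : {set V},
        (maxn h alpha)%:Z - (rank M (copies at_ (~: X)))%:Z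
          + (weight f (Z :\: X))%:Z - (weight (truncate g h) (X :\: Z))%:Z
        <= h%:Z * #|Z|%:Z)
    & (forall (X Z : {set V}) (P : {set {set V}}), subpartition P Z ->
        h%:Z * #|P|%:Z <=
        (entering F P)%:Z
          + Num.min (beta%:Z - (weight f (~: Z))%:Z)
              ((rank M (copies at_ X))%:Z - (weight f (X :\: Z))%:Z
                + (weight (truncate g h) (Z :\: X))%:Z))].

Hypothesis V_nonempty : (0 < #|V|)%N.

(** All four conditions are linear consequences of bounds on the root counts [m]: [f] and [g_h]
    pointwise, the rank on sets, the limits on the total, and the cut bound summed over the
    subpartition. *)
Lemma packing_conditions_necessary :
  has_hyperpacking F (fun (D : digraph V) (P : seq (arborescence D)) =>
    [/\ regular h P, independent_rooted at_ M P, bounded f g P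
      & limited alpha beta P]) -> packing_conditions.
Proof.
move=> [o [oP [t [tP [P [pP [hP [I indI IP] fgP abP]]]]]]].
pose m := rooted_at P.
have mh v : (m v <= truncate g h v)%N.
  by rewrite leq_min (rooted_at_regular v hP) andbT; case/andP: (fgP v).
have fm v : (f v <= m v)%N by case/andP: (fgP v).
have m_rank X : (weight m X <= rank M (copies at_ X))%N.
  rewrite /weight (eq_bigr _ (fun v _ => IP v)) card_copies.
  exact: independent_card.
have mT := size_rooted_at P; rewrite -/m in mT.
have /andP[am mb] := abP; rewrite mT in am mb.
(* Some vertex exists and lies in [h] of the arborescences; this accounts for [h] in the maximum of
   [h] and [alpha]. *)
have hm : (h <= \sum_v m v)%N.
  have /card_gt0P[v _] := V_nonempty.
  by rewrite -mT -(hP v); apply: count_size.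
split.
- by move=> v; apply: leq_trans (fm v) (mh v).
- exact: leq_trans am mb.
- move=> X Z; have := weightC m X; have := m_rank (~: X).
  have := sum_setDU m X Z; have := leq_weight (Z :\: X) fm; have := leq_weight (X :\: Z) mh.
  have : (weight m Z <= h * #|Z|)%N.
    rewrite mulnC -sum_nat_const; apply: leq_sum => v _.
    exact: rooted_at_regular.
  by lia.
move=> X Z Q /and3P[tQ Q0 QZ].
have : (h * #|Q| <= weight m (cover Q) + entering F Q)%N.
  apply: leq_trans (_ : _ <= \sum_(Y in Q) (weight m Y + #|@arcs_into _ (trim tP) Y|))%N _.
    rewrite mulnC -sum_nat_const; apply: leq_sum => Y YQ.
    by apply: packing_supply => //; apply: contraNneq Q0 => <-.
  rewrite big_split /= leq_add ?sum_arcs_into_le //.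
  by rewrite /weight (big_trivIset _ tQ).
have : (weight m (cover Q) <= weight m Z)%N.
  by rewrite /weight [leqRHS](big_setID (cover Q)) /= (setIidPr QZ) leq_addr.
have := weightC m Z; have := leq_weight (~: Z) fm; have := m_rank X.
have := sum_setDU m X Z; have := leq_weight (X :\: Z) fm; have := leq_weight (Z :\: X) mh.
by lia.
Qed.

Lemma roots_exist : packing_conditions -> exists (q : {set V} -> int) (m : V -> nat),
  [/\ supermodular q /\ q set0 = 0,
      forall X, X != set0 ->
        (\sum_(e : hyperedge F) (hy_set e \subset X) + h)%:Z
        - (\sum_(a : dyperedge F) enters (dy_tails a) (dy_head a) X)%:Z <= q X,
      forall X, q X <= (weight m X)%:Z + (\sum_(e : hyperedge F) meets (hy_set e) X)%:Z,
      forall v, (f v <= m v <= truncate g h v)%N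
    & (forall X, weight m X <= rank M (copies at_ X))%N
      /\ (alpha <= \sum_v m v <= beta)%N].
Proof.
move=> [fg ab cond3 cond4].
pose iE (X : {set V}) := (\sum_(e : hyperedge F) (hy_set e \subset X))%N.
pose tE X := (\sum_(e : hyperedge F) meets (hy_set e) X)%N.
pose dA X := (\sum_(a : dyperedge F) enters (dy_tails a) (dy_head a) X)%N.
have siE : supermodular (fun X => (iE X)%:Z).
  move=> X Y; rewrite /iE !Posz_sum.
  exact: (supermodular_sum _ (fun e => contained_supermodular (hy_set e))).
have stE : supermodular (fun X => - (tE X)%:Z).
  move=> X Y; rewrite /tE !Posz_sum -!sumrN.
  exact: (supermodular_sum _ (fun e => meets_submodular (hy_set e))).
have sdA : supermodular (fun X => - (dA X)%:Z).
  move=> X Y; rewrite /dA !Posz_sum -!sumrN.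
  exact: (supermodular_sum _ (fun a => enters_submodular (dy_tails a) (dy_head a))).
have sp : supermodular (fun X => (iE X + h)%:Z - (dA X)%:Z).
  by move=> X Y /=; have := siE X Y; have := sdA X Y; lia.
have [q [sq q0 pq qP]] := truncation sp.
have q_le X Z : q Z - (tE Z)%:Z <= Num.min (beta%:Z - (weight f (~: Z))%:Z)
    ((rank M (copies at_ X))%:Z - (weight f (X :\: Z))%:Z
      + (weight (truncate g h) (Z :\: X))%:Z).
  (* The partition attaining [q Z] is the subpartition to which the fourth condition is applied. *)
  have [P /and3P[/eqP cP tP P0] ->] := qP Z.
  have := cond4 X Z P; rewrite /subpartition tP P0 cP subxx => /(_ isT).
  have := entering_le F tP; rewrite cP -/(tE Z).
  have -> : \sum_(X in P) ((iE X + h)%:Z - (dA X)%:Z) =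
      (\sum_(X in P) iE X)%N%:Z + h%:Z * #|P|%:Z - (\sum_(X in P) dA X)%N%:Z.
    by rewrite sumrB -!Posz_sum big_split /= sum_nat_const mulnC PoszD PoszM.
  rewrite /iE /dA.
  move: (\sum_(X in P) _)%N (\sum_(X in P) _)%N (tE Z) (Num.min _ _) => a b c B.
  lia.
have weightE (m : V -> nat) X : (weight m X)%:Z = \sum_(v in X) (m v)%:Z by rewrite Posz_sum.
have [||||||||||m [fgm qm mT]] := @bounded_sandwich V (fun X => q X - (tE X)%:Z)
  (fun X => (rank M (copies at_ X))%:Z) (fun v => (f v)%:Z) (fun v => (truncate g h v)%:Z)
  alpha%:Z beta%:Z.
- by rewrite -card_gt0 cardsT.
- exact: supermodularD.
- move=> X Y /=; rewrite copiesI copiesU; exact: rank_supermodularN.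
- by rewrite q0 /tE big1 // => e _; rewrite /meets setI0 eqxx.
- rewrite (_ : copies _ _ = set0) ?rank0 //; by apply/setP => s; rewrite !inE.
- by move=> v; rewrite lez_nat.
- by rewrite lez_nat.
- by move=> X Z; have := q_le X Z; rewrite -!weightE; lia.
- by move=> Z; have := q_le set0 Z; rewrite -!weightE; lia.
(* The third condition for the complement of [X] and the empty [Z] says that the upper bounds leave
   room for a total of [alpha]. *)
- move=> X; have := cond3 (~: X) set0; rewrite setCK set0D setD0 cards0 -weightE.
  by rewrite [weight f set0]big_set0; lia.
pose n v := `|m v|%N.
have nE v : (n v)%:Z = m v by have := fgm v; rewrite /n; lia.
have wE X : (weight n X)%:Z = \sum_(v in X) m v.
  by rewrite weightE; apply: eq_bigr => v _; rewrite nE.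
exists q, n; split=> //.
- by move=> X; have /andP[+ _] := qm X; rewrite wE lerBlDr.
- by move=> v; have := fgm v; rewrite -nE !lez_nat.
split=> [X|]; first by have /andP[_] := qm X; rewrite -wE lez_nat.
by move: mT; rewrite -(eq_bigr _ (fun v _ => nE v)) -Posz_sum !lez_nat.
Qed.

Lemma packing_conditions_sufficient : packing_conditions ->
  has_hyperpacking F (fun (D : digraph V) (P : seq (arborescence D)) =>
    [/\ regular h P, independent_rooted at_ M P, bounded f g P
      & limited alpha beta P]).
Proof.
move=> /roots_exist[q [m [[sq q0] pq qm fmg [m_rank mT]]]].
have e0 (e : hyperedge F) : hy_set e != set0 by rewrite -card_gt0; apply: ltnW (hy_card e).
(* The heads have to cover what the roots leave of [q]. *)
have [|||||o oP qo] := @orient_supermodular _ _ (index_enum (hyperedge F)) (@hy_set _ F)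
  (fun X => q X - \sum_(v in X) (m v)%:Z).
- exact: index_enum_uniq.
- exact: e0.
- exact: supermodularD (supermodular_modularN _).
- by rewrite q0 big_set0.
- by move=> X; rewrite lerBlDr addrC -!Posz_sum; apply: qm.
have [||||t tP ht] := @trim_all V _ (index_enum (dyperedge (orient oP)))
  (@dy_tails _ (orient oP)) (@dy_head _ (orient oP)) (fun X => \sum_(v in X) (m v)%:Z) h%:Z.
- exact: index_enum_uniq.
- exact: dy_tails_neq0.
- exact: supermodular_modularN.
- move=> X X0; rewrite -!Posz_sum.
  (* Here [a] counts hyperedges inside [X], [c] heads in [X], [b] and [d] dyperedges entering [X]
     before and after orientation, [w] roots in [X], and [z] is [q X]; [a] and [b] cancel. *)
  have aux (a b c d w : nat) (z : int) : (c + b <= a + d)%N -> (a + h)%:Z - b%:Z <= z ->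
      z - w%:Z <= c%:Z -> h%:Z <= w%:Z + d%:Z by lia.
  apply: aux (orient_arcs_into oP X) (pq X X0) _.
  by rewrite !Posz_sum; apply: qo.
have mh v : (m v <= h)%N.
  by have /andP[_ /leq_trans] := fmg v; apply; apply: geq_minr.
have [|P [pP _ rP hP]] := @arborescence_packing V (trim tP) h setT m mh.
  move=> X X0; have := ht X X0; rewrite -!Posz_sum lez_nat.
  move/leq_trans; apply; rewrite addnC leq_add2r.
  rewrite [leqRHS](eq_bigl predT) => [|a]; last by rewrite inE.
  by apply: leq_sum => a _; rewrite /enters sub1set.
have [I indI mI] := independent_multiplicities m_rank.
exists o, oP, t, tP, P; split=> //; split=> //.
- by exists I => // v; rewrite rP.
- move=> v; rewrite rP; have /andP[-> /=] := fmg v.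
  by move/leq_trans; apply; apply: geq_minl.
- by rewrite /limited size_rooted_at; under eq_bigr do rewrite rP.
Qed.
End Conditions.

Theorem theorem13 (V : finType) (V_nonempty : (0 < #|V|)%N)
    (F : mixed_hypergraph V) (f g : V -> nat) (h alpha beta : nat)
    (S : finType) (at_ : S -> V) (M : matroid S) :
  has_hyperpacking F (fun (D : digraph V) (P : seq (arborescence D)) =>
    [/\ regular h P, independent_rooted at_ M P, bounded f g P
      & limited alpha beta P])
  <->
  [/\ (forall v : V, (f v <= truncate g h v)%N),
      (alpha <= beta)%N,
      (forall X Z : {set V},
        (maxn h alpha)%:Z - (rank M (copies at_ (~: X)))%:Z
          + (weight f (Z :\: X))%:Z - (weight (truncate g h) (X :\: Z))%:Z
        <= h%:Z * #|Z|%:Z)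
    & (forall (X Z : {set V}) (P : {set {set V}}), subpartition P Z ->
        h%:Z * #|P|%:Z <=
        (entering F P)%:Z
          + Num.min (beta%:Z - (weight f (~: Z))%:Z)
              ((rank M (copies at_ X))%:Z - (weight f (X :\: Z))%:Z
                + (weight (truncate g h) (Z :\: X))%:Z))].
Proof.
split; first exact: packing_conditions_necessary.
exact: packing_conditions_sufficient.
Qed.
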